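(* Let $P\subset\mathbf{R}^d$ be a generalized polytope, let $\mathcal{V}_P$ be the set of algebraic vertices of $P$, and let $\mathcal{T}_P$ be the set of simplices all of whose vertices lie in $\mathcal{V}_P$. Then there are integers $\alpha_i$ such that $$[P]=\sum_{T_i\in\mathcal{T}_P}\alpha_i[T_i],$$ where the equality holds throughout $\mathbf{R}^d$ except perhaps on a set of measure zero. Moreover, if $[P]$ is represented (up to a set of measure zero) as a linear combination of indicator functions of some finite number of simplices, then the set of vertices of these simplices must contain $\mathcal{V}_P$.
   Context: $[S]$ denotes the indicator function of a set $S\subset\mathbf{R}^d$. A convex polyhedron is the intersection of finitely many closed half-spaces of $\mathbf{R}^d$. A generalized polyhedron is a finite union of convex polyhedra; a generalized polytope is a bounded generalized polyhedron. Tangent cones: for a convex polyhedron $P$ and a point $\mathbf{v}$, put $\mathrm{tcone}(P,\mathbf{v})=\{\mathbf{v}+\mathbf{x}:\ \mathbf{v}+\varepsilon\mathbf{x}\in P\text{ for some }\varepsilon>0\}$ if $\mathbf{v}\in P$, and $\mathrm{tcone}(P,\mathbf{v})=\emptyset$ if $\mathbf{v}\notin P$. If a generalized polyhedron $P$ is the union of convex polyhedra $P_1,\dots,P_n$, put $\mathrm{tcone}(P,\mathbf{v})=\bigcup_{i}\mathrm{tcone}(P_i,\mathbf{v})$. A cone with apex $\mathbf{p}$ is a generalized polyhedron $C$ such that $\mathbf{p}+t(\mathbf{x}-\mathbf{p})\in C$ for all $\mathbf{x}\in C$, $t\ge 0$. A line-cone is a cone that is a union of parallel lines. A point $\mathbf{v}\in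 P$ is an algebraic vertex of a generalized polyhedron $P$ if the indicator function of $\mathrm{tcone}(P,\mathbf{v})$ cannot be represented, up to a set of measure zero, as a (finite, real) linear combination of indicator functions of line-cones. The set of algebraic vertices is finite, so the sum over $\mathcal{T}_P$ is finite. *)

(* Defs.v *)
From HB Require Import structures.
From mathcomp Require Import all_boot all_order all_algebra finmap.
From mathcomp Require Import all_classical all_reals all_analysis.
Import Order.TTheory GRing.Theory Num.Theory.
Import numFieldNormedType.Exports.
Set Implicit Arguments.
Unset Strict Implicit.
Unset Printing Implicit Defensive.
Local Open Scope classical_set_scope.
Local Open Scope ring_scope.

Section Definitions.
Context {R : realType} {d : nat}.
Implicit Types (P Q C S : set 'rV[R]_d) (u v x y : 'rV[R]_d).

(* Lebesgue-null sets. The library has Lebesgue measure on R only, hence the  *)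
(* usual characterization by countable covers with boxes. Indexing the cover  *)
(* by a subset D of nat allows finite covers, which matters only for d = 0,   *)
(* where the unique box is a point of volume 1.                               *)
Definition box (a b : 'rV[R]_d) : set 'rV[R]_d :=
  [set x | forall i, a 0 i <= x 0 i <= b 0 i].

Definition lebesgue_null S : Prop :=
  forall e : R, 0 < e -> exists (D : set nat) (a b : nat -> 'rV[R]_d),
    [/\ forall k i, a k 0 i <= b k 0 i,
        S `<=` \bigcup_(k in D) box (a k) (b k) &
        (\esum_(k in D) (\prod_(i < d) (b k 0 i - a k 0 i))%:E <= e%:E)%E].

Definition eq_ae (f g : 'rV[R]_d -> R) : Prop :=
  lebesgue_null [set x | f x <> g x].

Definition halfspace S : Prop :=
  exists (a : 'cV[R]_d) (b : R),
    a != 0 /\ S = [set x | (x *m a) 0 0 <= b].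

Definition convex_polyhedron P : Prop :=
  exists (m : nat) (H : 'I_m -> set 'rV[R]_d),
    (forall j, halfspace (H j)) /\ P = \bigcap_j H j.

Definition polyhedral_union (n : nat) (Q : 'I_n -> set 'rV[R]_d) P : Prop :=
  (forall i, convex_polyhedron (Q i)) /\ P = \bigcup_i Q i.

Definition generalized_polyhedron P : Prop :=
  exists (n : nat) (Q : 'I_n -> set 'rV[R]_d), polyhedral_union Q P.

Definition generalized_polytope P : Prop :=
  generalized_polyhedron P /\ bounded_set P.

Definition convex_tcone P v : set 'rV[R]_d :=
  [set v + x | x in [set x | P v /\ exists2 e : R, 0 < e & P (v + e *: x)]].

(* Lemma tconeE below shows that \bigcup_i convex_tcone (Q i) v is the same   *)
(* set for all decompositions Q of P, so collecting all decompositions is the *)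
(* same as using any one of them.                                             *)
Definition tcone P v : set 'rV[R]_d :=
  [set y | exists (n : nat) (Q : 'I_n -> set 'rV[R]_d),
     polyhedral_union Q P /\ (\bigcup_i convex_tcone (Q i) v) y].

Definition cone_with_apex (p : 'rV[R]_d) C : Prop :=
  generalized_polyhedron C /\
  forall x, C x -> forall t : R, 0 <= t -> C (p + t *: (x - p)).

Definition line_cone C : Prop :=
  (exists p, cone_with_apex p C) /\
  exists u (X : set 'rV[R]_d),
    u != 0 /\ C = \bigcup_(x in X) [set x + t *: u | t in [set: R]].

Definition line_cone_combination_ae S : Prop :=
  exists (n : nat) (C : 'I_n -> set 'rV[R]_d) (c : 'I_n -> R),
    (forall i, line_cone (C i)) /\
    eq_ae \1_S (fun x => \sum_(i < n) c i * \1_(C i) x).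

Definition algebraic_vertices P : set 'rV[R]_d :=
  [set v | P v /\ ~ line_cone_combination_ae (tcone P v)].

(* A simplex, of any dimension from 0 to d, is represented by the finite set  *)
(* A of its vertices; as a subset of R^d it is conv_hull A.                   *)
Implicit Type A : {fset 'rV[R]_d}.

Definition affinely_independent A : Prop :=
  forall c : 'rV[R]_d -> R,
    \sum_(v <- A) c v = 0 -> \sum_(v <- A) c v *: v = 0 ->
    forall v, v \in A -> c v = 0.

Definition conv_hull A : set 'rV[R]_d :=
  [set x | exists c : 'rV[R]_d -> R,
     [/\ forall v, v \in A -> 0 <= c v,
         \sum_(v <- A) c v = 1 &
         x = \sum_(v <- A) c v *: v]].

Definition simplex A : Prop := A != fset0 /\ affinely_independent A.

Definition simplices_on (V : set 'rV[R]_d) : set {fset 'rV[R]_d} :=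
  [set A | simplex A /\ [set` A] `<=` V].

End Definitions.

Section Wellposedness.
Context {R : realType} {d : nat}.
Implicit Types (P Q C S : set 'rV[R]_d) (u v x y : 'rV[R]_d).

Let dot x (a : 'cV[R]_d) : R := (x *m a) 0 0.

Let dotD x y a : dot (x + y) a = dot x a + dot y a.
Proof. by rewrite /dot mulmxDl mxE. Qed.

Let dotZ (t : R) x a : dot (t *: x) a = t * dot x a.
Proof. by rewrite /dot -scalemxAl mxE. Qed.

Let dotB x y a : dot (x - y) a = dot x a - dot y a.
Proof. by rewrite dotD -scaleN1r dotZ mulN1r. Qed.

Lemma convex_tconeP P v y : convex_tcone P v y <->
  P v /\ exists2 e : R, 0 < e & P (v + e *: (y - v)).
Proof.
split=> [[x [Pv [e e0 Pe]] <-]|[Pv [e e0 Pe]]].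
  by split=> //; exists e => //; rewrite addrAC subrr add0r.
exists (y - v); last by rewrite addrC subrK.
by split=> //; exists e.
Qed.

Lemma convex_polyhedronP P : convex_polyhedron P <->
  exists2 s : seq ('cV[R]_d * R), {in s, forall h, h.1 != 0} &
    P = [set x | {in s, forall h, (x *m h.1) 0 0 <= h.2}].
Proof.
split=> [[m [H [Hh ->]]]|[s s0 ->]].
  have /boolp.choice[f fP] : forall j, exists h : 'cV[R]_d * R,
      h.1 != 0 /\ H j = [set x | (x *m h.1) 0 0 <= h.2].
    by move=> j; have [a [b [a0 ->]]] := Hh j; exists (a, b).
  exists [seq f j | j <- enum 'I_m].
    by move=> _ /mapP[j _ ->]; case: (fP j).
  apply/seteqP; split=> x /=.
    move=> Hx _ /mapP[j _ ->].
    by have := Hx j I; case: (fP j) => _ ->.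
  move=> Hx j _; case: (fP j) => _ -> /=; apply: Hx.
  by apply: map_f; rewrite mem_enum.
exists (size s), (fun j => let h := tnth (in_tuple s) j in
  [set x | (x *m h.1) 0 0 <= h.2]); split.
  move=> j; set h := tnth _ _; exists h.1, h.2; split=> //.
  by apply: s0; exact: mem_tnth.
apply/seteqP; split=> x /= Hx.
  by move=> j _ /=; apply: Hx; exact: mem_tnth.
move=> h /(tnthP (in_tuple s))[j ->]; exact: (Hx j I).
Qed.

Let small_all (T : eqType) (s : seq T) (F : T -> R -> Prop) :
  (forall i, i \in s -> exists2 e0 : R, 0 < e0 &
    forall e, 0 < e -> e <= e0 -> F i e) ->
  exists2 e0 : R, 0 < e0 &
    forall i, i \in s -> forall e, 0 < e -> e <= e0 -> F i e.
Proof.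
elim: s => [_|i s IH H]; first by exists 1.
have [|e1 e10 H1] := IH; first by move=> j js; apply: H; rewrite inE js orbT.
have [|e2 e20 H2] := H i; first by rewrite mem_head.
exists (Num.min e1 e2); first by rewrite lt_min e10.
move=> j; rewrite inE => /predU1P[->|js] e e0; rewrite le_min => /andP[le1 le2].
  exact: H2.
exact: H1.
Qed.

Let small_pos (c k : R) : 0 < c -> exists2 e0 : R, 0 < e0 &
  forall e, 0 < e -> e <= e0 -> 0 < c + e * k.
Proof.
move=> c0; have k1 : 0 < 1 + `|k| by rewrite ltr_wpDr.
exists (c / (1 + `|k|)); first by rewrite divr_gt0.
move=> e e0; rewrite ler_pdivlMr// mulrDr mulr1 => ec.
have : - (e * k) <= e * `|k|.
  by rewrite -mulrN ler_wpM2l ?(ltW e0)// -normrN ler_norm.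
by move=> H; rewrite -[e * k]opprK subr_gt0 (le_lt_trans H)// (lt_le_trans _ ec)// ltrDr.
Qed.

Lemma convex_tcone_active (s : seq ('cV[R]_d * R)) v :
  let P := [set x | {in s, forall h, (x *m h.1) 0 0 <= h.2}] in
  P v -> convex_tcone P v =
    [set y | {in [seq h <- s | (v *m h.1) 0 0 == h.2],
              forall h, (y *m h.1) 0 0 <= h.2}].
Proof.
move=> P Pv; apply/seteqP; split=> y.
  move=> /convex_tconeP[_ [e e0 Pe]] h; rewrite mem_filter => /andP[/eqP vh hs].
  have := Pe h hs; rewrite -!/(dot _ _) in vh *.
  by rewrite dotD dotZ dotB vh gerDl pmulr_rle0// subr_le0.
move=> /= Hy; apply/convex_tconeP; split=> //.
have [|e e0 He] := @small_all _ s
    (fun h e => dot (v + e *: (y - v)) h.1 <= h.2).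
  move=> h hs; have := Pv h hs; rewrite le_eqVlt => /predU1P[vh|vh].
    exists 1 => // e e0 _; have := Hy h; rewrite mem_filter vh eqxx hs.
    move=> /(_ isT); rewrite -!/(dot _ _) in vh *.
    by rewrite dotD dotZ dotB vh gerDl pmulr_rle0// subr_le0.
  have [|e0 e00 H] := @small_pos (h.2 - dot v h.1) (- dot (y - v) h.1).
    by rewrite subr_gt0.
  exists e0 => // e epos /(H e epos); rewrite (dotD v) dotZ mulrN -addrA -opprD.
  by rewrite subr_gt0 => /ltW.
by exists e => //= h hs; apply: He.
Qed.

Let tcone_sub n1 n2 (Q1 : 'I_n1 -> set 'rV[R]_d) (Q2 : 'I_n2 -> set 'rV[R]_d)
    P v :
  polyhedral_union Q1 P -> polyhedral_union Q2 P ->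
  \bigcup_i convex_tcone (Q1 i) v `<=` \bigcup_i convex_tcone (Q2 i) v.
Proof.
move=> [cQ1 P1] [cQ2 P2] y [i _ /convex_tconeP[Qv [e1 e10 Qe]]].
apply: contrapT => Hn.
have [|e2 e20 H2] := @small_all _ (enum 'I_n2)
    (fun j e => ~ Q2 j (v + e *: (y - v))).
  move=> j _; have [Q2v|nQ2v] := pselect (Q2 j v).
    exists 1 => // e e0 _ Qje; apply: Hn; exists j => //.
    by apply/convex_tconeP; split=> //; exists e.
  move: nQ2v; have /convex_polyhedronP[s _ ->] := cQ2 j => /= nQ2v.
  have [h hs /negP] : exists2 h, h \in s & ~ (v *m h.1) 0 0 <= h.2.
    by apply: contrapT => K; apply: nQ2v => h hs; apply: contrapT => L;
      apply: K; exists h.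
  rewrite -ltNge -/(dot _ _) -subr_gt0 => /(@small_pos _ (dot (y - v) h.1)).
  move=> [e0 e00 H]; exists e0 => // e epos ele /(_ h hs).
  have := H e epos ele.
  by rewrite -/(dot _ _) (dotD v) dotZ addrAC subr_gt0 ltNge => /negP.
pose e := Num.min e1 e2.
have epos : 0 < e by rewrite lt_min e10.
have : P (v + e *: (y - v)).
  rewrite P1; exists i => //.
  move: Qv Qe; have /convex_polyhedronP[s _ ->] := cQ1 i => /= Qv Qe h hs.
  have := Qv h hs; have := Qe h hs; rewrite -!/(dot _ _) !(dotD v) !dotZ => ub1 ub0.
  have [k0|k0] := lerP (dot (y - v) h.1) 0.
    rewrite (le_trans _ ub0)// gerDl pmulr_rle0//.
  rewrite (le_trans _ ub1)// lerD2l ler_wpM2r ?(ltW k0)//.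
  by rewrite /e ge_min lexx.
rewrite P2 => -[j _]; apply: H2 => //; first by rewrite mem_enum.
by rewrite /e ge_min lexx orbT.
Qed.

Lemma tconeE n (Q : 'I_n -> set 'rV[R]_d) P v :
  polyhedral_union Q P -> tcone P v = \bigcup_i convex_tcone (Q i) v.
Proof.
move=> PQ; apply/seteqP; split=> y.
  by move=> [m [Q' [PQ' /(tcone_sub PQ' PQ)]]].
by move=> H; exists n, Q.
Qed.

Lemma lebesgue_null0 : lebesgue_null (@set0 'rV[R]_d).
Proof.
move=> e e0; exists set0, (fun=> 0), (fun=> 0); split=> //.
by rewrite esum_set0 lee_fin ltW.
Qed.

Lemma convex_polyhedron0 u : u != 0 -> convex_polyhedron (@set0 'rV[R]_d).
Proof.
move=> u0; have a0 : u^T != 0 by rewrite -(inj_eq trmx_inj) trmxK trmx0.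
apply/convex_polyhedronP; exists [:: (u^T, 0); (- u^T, -1)].
  by move=> h; rewrite !inE => /orP[] /eqP-> //=; rewrite oppr_eq0.
apply/esym/seteqP; split=> // x /= Hx.
have := Hx _ (mem_head _ _); have := Hx (- u^T, -1).
rewrite !inE eqxx orbT => /(_ isT) /=.
rewrite mulmxN mxE lerN2 => /le_trans H /H.
by rewrite ler10.
Qed.

(* With finite_simplices_on, this makes sums \sum_(A \in _) F A over the      *)
(* simplices on the algebraic vertices genuine sums: such a sum takes the     *)
(* default value 0 when F has infinite support.                               *)
Lemma finite_algebraic_vertices P :
  generalized_polyhedron P -> finite_set (algebraic_vertices P).
Proof.
move=> [n [Q PQ]]; have [cQ PE] := PQ.
have /boolp.choice[s sP] : forall i, exists s : seq ('cV[R]_d * R),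
    {in s, forall h, h.1 != 0} /\
    Q i = [set x | {in s, forall h, (x *m h.1) 0 0 <= h.2}].
  by move=> i; have /convex_polyhedronP[s s0 sE] := cQ i; exists s.
pose L := flatten [seq s i | i <- enum 'I_n].
pose act v : {fset 'cV[R]_d * R} := [fset h in L | (v *m h.1) 0 0 == h.2]%fset.
have actP v u : algebraic_vertices P v ->
    (forall h, h \in act v -> dot u h.1 = 0) -> u = 0.
  move=> [Pv nlc] uact; apply: contrapT => /eqP u0; apply: nlc.
  have Hact i : Q i v -> convex_tcone (Q i) v =
      [set y | {in [seq h <- s i | (v *m h.1) 0 0 == h.2],
                forall h, (y *m h.1) 0 0 <= h.2}].
    by case: (sP i) => _ ->; exact: convex_tcone_active.
  have gp : generalized_polyhedron (tcone P v).
    exists n, (fun i => convex_tcone (Q i) v); split; last exact: tconeE.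
    move=> i; have [Qv|nQv] := pselect (Q i v).
      rewrite Hact//; apply/convex_polyhedronP.
      exists [seq h <- s i | (v *m h.1) 0 0 == h.2] => //.
      by move=> h; rewrite mem_filter => /andP[_ hs]; case: (sP i) => + _; apply.
    rewrite (_ : convex_tcone _ _ = set0); first exact: convex_polyhedron0 u0.
    by rewrite -subset0 => y /convex_tconeP[].
  have lc : line_cone (tcone P v).
    split.
      exists v; split=> // y; rewrite (tconeE v PQ) => -[i _ /convex_tconeP].
      move=> [Qv [e e0 Qe]] t; rewrite le_eqVlt => /predU1P[<-|t0].
        exists i => //; apply/convex_tconeP; split=> //; exists 1 => //.
        by rewrite scale0r addr0 subrr scaler0 addr0.
      exists i => //; apply/convex_tconeP; split=> //.
      exists (e / t); first exact: divr_gt0.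
      by rewrite addrAC subrr add0r scalerA divfK ?gt_eqF.
    exists u, (tcone P v); split=> //; apply/seteqP; split=> y.
      by move=> Cy; exists y => //; exists 0 => //; rewrite scale0r addr0.
    move=> [x + [t _ <-]]; rewrite (tconeE v PQ) => -[i _ xi].
    have [Qv _] := (convex_tconeP _ _ _).1 xi.
    move: xi; rewrite Hact//= => Hx; exists i => //; rewrite Hact//= => h hs.
    rewrite -/(dot _ _) dotD dotZ uact ?mulr0 ?addr0; first exact: Hx.
    rewrite !inE/= andbC; move: hs; rewrite mem_filter => /andP[-> hs] /=.
    by apply/flattenP; exists (s i) => //; apply: map_f; rewrite mem_enum.
  exists 1%N, (fun=> tcone P v), (fun=> 1); split=> //.
  rewrite /eq_ae [X in lebesgue_null X](_ : _ = set0); first exact: lebesgue_null0.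
  by rewrite -subset0 => x /=; rewrite big_ord1 mul1r.
have inj : {in algebraic_vertices P &, injective act}.
  move=> v w /set_mem Vv _ vw; apply/eqP; rewrite -subr_eq0; apply/eqP.
  apply: (actP v) => // h hv; rewrite dotB.
  have := hv; rewrite vw; move: hv; rewrite !inE/=.
  by rewrite /dot => /andP[_ /eqP->] /andP[_ /eqP->]; rewrite subrr.
rewrite -(eq_finite_set (inj_card_eq inj)).
pose LF := [fset h in L]%fset.
apply: (@finite_subfset _ (fpowerset LF)) => _ [v _ <-] /=.
rewrite fpowersetE; apply/fsubsetP => h.
by rewrite !inE/= => /andP[].
Qed.

Lemma finite_simplices_on (V : set 'rV[R]_d) :
  finite_set V -> finite_set (simplices_on V).
Proof.
move=> finV; apply: (@finite_subfset _ (fpowerset (fset_set V))) => A [_ AV] /=.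
rewrite fpowersetE; apply/fsubsetP => v /AV Vv.
by rewrite in_fset_set// inE.
Qed.

End Wellposedness.

(* Main.v *)
Require Import Defs.
From HB Require Import structures.
From mathcomp Require Import all_boot all_order all_algebra finmap.
From mathcomp Require Import all_classical all_reals all_analysis.
From mathcomp Require Import measurable_realfun.
From mathcomp Require Import ring lra.
Import Order.TTheory GRing.Theory Num.Theory.
Import numFieldNormedType.Exports.
Set Implicit Arguments.
Unset Strict Implicit.
Unset Printing Implicit Defensive.
Local Open Scope classical_set_scope.
Local Open Scope ring_scope.

(** Both halves replace sets by polyhedral functions (step functions determined
    by the signs of finitely many affine forms) and almost everywhere equality
    by equality off finitely many hyperplanes.  The two notions of equality
    agree for such functions: a hyperplane is null, and a box is not
    ([eq_off_eq_ae], [eq_ae_eq_off]).  Since a polyhedral set agrees near v with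
    its tangent cone at v, a point v is an algebraic vertex as soon as the
    indicator is not, near v, a sum of polyhedral functions each of which is
    invariant under some translation ([locally_cylindrical],
    [not_locally_cylindrical_vertex]).  This local condition, which makes sense
    for functions, defines the vertices of a polyhedral function below.

    Existence of a decomposition is proved for all integer-valued polyhedral
    functions f with bounded support, by induction on the dimension
    ([simplicial_decomposition]).  Fix a point w and follow the ray from w
    through a generic point x to infinity, where f vanishes: f x is the sum of
    the jumps of f met beyond x ([ray_formula]).  Grouped by hyperplanes, f is
    the sum of the cones from w over the jump functions of f across the
    hyperplanes not containing w.  Each jump function lives in one dimension
    less and is a combination of simplices spanned by its own vertices; coning
    such a simplex from w gives a simplex ([facet_contribution]).  What makes
    the induction close is that a vertex of the jump across a hyperplane is a
    vertex of f ([locally_cylindrical_jump]): a function invariant under a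
    translation u has, across a hyperplane, a jump which is invariant under u
    if u is parallel to the hyperplane, and no jump otherwise.  Hence, if w is
    chosen among the vertices of f, all simplices have their vertices there.
    Integrality is preserved because jumps of integer-valued functions are
    integer-valued.

    For the minimality statement, take a point v that is a vertex of none of
    the given simplices.  The tangent cone at v of each of them is a line-cone
    ([line_cone_tcone_simplex]), and passing to germs at v in the given identity
    writes the tangent cone of P at v as a combination of these line-cones
    ([simplices_cover_vertices]). *)

(** * Affine forms, polyhedral functions and one-sided limits *)

Section Forms.
Context {R : realType} {d : nat}.
Implicit Types (h k : 'cV[R]_d * R) (a : 'cV[R]_d) (x y u v n : 'rV[R]_d).
Implicit Types (s t : seq ('cV[R]_d * R)) (f g : 'rV[R]_d -> R).

Definition lin a x : R := (x *m a) 0 0.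
Definition ev h x : R := lin h.1 x - h.2.

Lemma linD a x y : lin a (x + y) = lin a x + lin a y.
Proof. by rewrite /lin mulmxDl mxE. Qed.

Lemma linZ a c x : lin a (c *: x) = c * lin a x.
Proof. by rewrite /lin -scalemxAl mxE. Qed.

Lemma linN a x : lin a (- x) = - lin a x.
Proof. by rewrite -scaleN1r linZ mulN1r. Qed.

Lemma linB a x y : lin a (x - y) = lin a x - lin a y.
Proof. by rewrite linD linN. Qed.

Lemma lin0 a : lin a 0 = 0.
Proof. by rewrite /lin mul0mx mxE. Qed.

Lemma lin0l x : lin 0 x = 0.
Proof. by rewrite /lin mulmx0 mxE. Qed.

Lemma linBl a b x : lin (a - b) x = lin a x - lin b x.
Proof. by rewrite /lin mulmxBr !mxE. Qed.

Lemma linZl a c x : lin (c *: a) x = c * lin a x.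
Proof. by rewrite /lin -scalemxAr mxE. Qed.

Lemma lin_eq0 a : (forall x, lin a x = 0) -> a = 0.
Proof.
move=> a0; apply/matrixP => i j; rewrite [j]ord1 mxE.
by have := a0 (delta_mx 0 i); rewrite /lin -rowE mxE.
Qed.

Lemma lin_neq0 a : a != 0 -> exists x, lin a x != 0.
Proof.
move=> a0; apply: contrapT => H; move/eqP: a0; apply; apply: lin_eq0 => x.
by apply: contrapT => /eqP K; apply: H; exists x.
Qed.

Lemma evD h x u : ev h (x + u) = ev h x + lin h.1 u.
Proof. by rewrite /ev linD addrAC. Qed.

Lemma ev_const h x y : h.1 = 0 -> ev h x = ev h y.
Proof. by move=> h0; rewrite /ev h0 !lin0l. Qed.

Definition same_side s x y :=
  forall h, h \in s -> Num.sg (ev h x) = Num.sg (ev h y).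

Definition adapted s f := forall x y, same_side s x y -> f x = f y.

(** Modulo null sets these are the step functions spanned by the indicators of
    convex polyhedra.  Being a function of the signs of finitely many affine
    forms is a condition that sums, one-sided limits and affine changes of
    variables visibly preserve, without any bookkeeping of polyhedra. *)
Definition polyhedral f := exists s, adapted s f.

(** Forms without linear part are exempt: their zero set is not a hyperplane. *)
Definition off s x := forall h, h \in s -> h.1 != 0 -> ev h x != 0.

(** For fixed v these x form an open neighborhood of v.  Such neighborhoods pull
    back along affine maps by pulling back the forms, so no norm is needed. *)
Definition near_side s v x :=
  forall h, h \in s -> ev h v != 0 -> Num.sg (ev h x) = Num.sg (ev h v).

Lemma off_cat s t x : off (s ++ t) x <-> off s x /\ off t x.
Proof.
split=> [H|[H1 H2] h]; last by rewrite mem_cat => /orP[]; [apply: H1|apply: H2].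
by split=> h hs; apply: H; rewrite mem_cat hs ?orbT.
Qed.

Lemma off_cons h s x : off (h :: s) x <-> (h.1 != 0 -> ev h x != 0) /\ off s x.
Proof.
split=> [H|[H1 H2] k]; last by rewrite inE => /predU1P[->|]; [|apply: H2].
by split=> [|k ks]; apply: H; rewrite inE ?eqxx// ks orbT.
Qed.

Lemma off_sub s t x : {subset s <= t} -> off t x -> off s x.
Proof. by move=> st H h hs; apply: H; apply: st. Qed.

Lemma near_side_sub s t v x : {subset s <= t} ->
  near_side t v x -> near_side s v x.
Proof. by move=> st H h hs; apply: H; apply: st. Qed.

Lemma polyhedral_cst (c : R) : polyhedral (fun=> c).
Proof. by exists [::]. Qed.

Lemma polyhedral_map2 (op : R -> R -> R) f g :
  polyhedral f -> polyhedral g -> polyhedral (fun x => op (f x) (g x)).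
Proof.
move=> [s sf] [t tg]; exists (s ++ t) => x y xy.
by rewrite (sf x y) 1?(tg x y)// => h hs; apply: xy; rewrite mem_cat hs ?orbT.
Qed.

Lemma polyhedral_sum (m : nat) (F : 'I_m -> 'rV[R]_d -> R) :
  (forall i, polyhedral (F i)) -> polyhedral (fun x => \sum_(i < m) F i x).
Proof.
move=> /boolp.choice[s sF].
exists (flatten [seq s i | i <- enum 'I_m]) => x y xy.
apply: eq_bigr => i _; apply: (sF i) => h hs; apply: xy.
by apply/flattenP; exists (s i) => //; apply: map_f; rewrite mem_enum.
Qed.

(** The sign of c + e * k for all small positive e; see near_sgr. *)
Definition sgr2 (c k : R) : R := if c == 0 then Num.sg k else Num.sg c.

Lemma near_sgr (c k : R) : \forall e \near 0^'+, Num.sg (c + e * k) = sgr2 c k.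
Proof.
rewrite /sgr2; case: eqVneq => [->|c0].
  near=> e; rewrite add0r sgrM gtr0_sg ?mul1r//.
have k1 : 0 < 1 + `|k| by rewrite ltr_wpDr.
have c1 : 0 < `|c| / (1 + `|k|) by rewrite divr_gt0// normr_gt0.
near=> e.
have e0 : 0 < e by [].
have : e < `|c| / (1 + `|k|) by near: e; exact: nbhs_right_lt.
rewrite ltr_pdivlMr// => ec.
have ek : e * `|k| < `|c| by lra.
have := ler_norm (e * k); have := ler_norm (- (e * k)).
rewrite normrN normrM (gtr0_norm e0) => H1 H2.
have [cp|cn|c00] := ltgtP c 0; last by rewrite c00 eqxx in c0.
  by rewrite ltr0_sg ?ltr0_sg// ; rewrite (ltr0_norm cp) in ek; lra.
by rewrite gtr0_sg ?gtr0_sg//; rewrite (gtr0_norm cn) in ek; lra.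
Unshelve. all: by end_near. Qed.

Lemma near_all (T : eqType) (r : seq T) (Q : T -> R -> Prop) :
  (forall i, i \in r -> \forall e \near 0^'+, Q i e) ->
  \forall e \near 0^'+, forall i, i \in r -> Q i e.
Proof.
elim: r => [_|i r IH H]; first by near=> e.
have H1 := H i (mem_head _ _).
have H2 : \forall e \near 0^'+, forall i, i \in r -> Q i e.
  by apply: IH => j jr; apply: H; rewrite inE jr orbT.
near=> e => j; rewrite inE => /predU1P[->|]; first by near: e.
by move: j; near: e.
Unshelve. all: by end_near. Qed.

Lemma near_ev s x n : \forall e \near 0^'+,
  forall h, h \in s -> Num.sg (ev h (x + e *: n)) = sgr2 (ev h x) (lin h.1 n).
Proof.
apply: near_all => h _.
by have := near_sgr (ev h x) (lin h.1 n); apply: filterS => e; rewrite evD linZ.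
Qed.

Lemma near_near_side s v x n : near_side s v x ->
  \forall e \near 0^'+, near_side s v (x + e *: n).
Proof.
move=> vx; have := near_ev s x n; apply: filterS => e H h hs hv.
have hx : ev h x == 0 = false.
  by rewrite -sgr_eq0 (vx h hs hv) sgr_eq0 (negbTE hv).
by rewrite (H h hs) /sgr2 hx vx.
Qed.

Lemma near_off s x n :
  (forall h, h \in s -> h.1 != 0 -> ev h x = 0 -> lin h.1 n != 0) ->
  \forall e \near 0^'+, off s (x + e *: n).
Proof.
move=> H; have := near_ev s x n; apply: filterS => e He h hs h0.
rewrite -sgr_eq0 (He h hs) /sgr2.
have [hx|] := eqVneq (ev h x) 0; rewrite sgr_eq0//.
exact: H.
Qed.

Definition dlim f n x : R := lim (f (x + e *: n) @[e --> 0^'+]).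

Lemma dlimE f n x c :
  (\forall e \near 0^'+, f (x + e *: n) = c) -> dlim f n x = c.
Proof. by move=> H; apply: lim_near_cst. Qed.

(** The limit exists, and is attained, because the signs of the finitely many
    forms that determine f stabilize along the ray. *)
Lemma adapted_dlim s f n x : adapted s f ->
  \forall e \near 0^'+, f (x + e *: n) = dlim f n x.
Proof.
move=> sf; have H := near_ev s x n.
have [e1 He1] := filter_ex H.
suff K : \forall e \near 0^'+, f (x + e *: n) = f (x + e1 *: n).
  by rewrite (dlimE K).
apply: filterS H => e He; apply: sf => h hs.
by rewrite (He h hs) (He1 h hs).
Qed.

Lemma polyhedral_dlimP f n x : polyhedral f ->
  \forall e \near 0^'+, f (x + e *: n) = dlim f n x.
Proof. by move=> [s /adapted_dlim]. Qed.

(** The eventual signs of the forms determine the limit; base point and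
    direction may differ.  Jumps are computed by such changes of direction. *)
Lemma adapted_dlim_eq s f x n y m : adapted s f ->
  (forall h, h \in s ->
     sgr2 (ev h x) (lin h.1 n) = sgr2 (ev h y) (lin h.1 m)) ->
  dlim f n x = dlim f m y.
Proof.
move=> sf H; have Hx := near_ev s x n; have Hy := near_ev s y m.
have fx := adapted_dlim n x sf; have fy := adapted_dlim m y sf.
have [e [[e1 e2] [e3 e4]]] :=
  filter_ex (filterI (filterI Hx Hy) (filterI fx fy)).
by rewrite -e3 -e4; apply: sf => h hs; rewrite e1// e2// H.
Qed.

Lemma adapted_dlim_adapted s f n : adapted s f -> adapted s (dlim f n).
Proof.
move=> sf x y xy; apply: (adapted_dlim_eq sf) => h hs.
by rewrite /sgr2 -(sgr_eq0 (ev h x)) (xy h hs) sgr_eq0.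
Qed.

Lemma dlim_near_sum (m : nat) (F : 'I_m -> 'rV[R]_d -> R) f n x :
  (forall i, polyhedral (F i)) ->
  (\forall e \near 0^'+, f (x + e *: n) = \sum_(i < m) F i (x + e *: n)) ->
  dlim f n x = \sum_(i < m) dlim (F i) n x.
Proof.
move=> pF H; apply: dlimE.
have : \forall e \near 0^'+, forall i, F i (x + e *: n) = dlim (F i) n x.
  by apply: filter_forall => i; apply: polyhedral_dlimP.
by apply: filterS2 H => e -> H2; apply: eq_bigr.
Qed.

(** The drop of f when x is crossed in the direction n.  With n pointing away
    from w these are the summands of the ray formula. *)
Definition jump f n x := dlim f (- n) x - dlim f n x.

Lemma adapted_jump s f n : adapted s f -> adapted s (jump f n).
Proof.
move=> sf x y xy; rewrite /jump.
by rewrite !(adapted_dlim_adapted _ sf xy).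
Qed.

End Forms.

(** * Translation-invariant functions and jumps across hyperplanes *)

Section Cylindrical.
Context {R : realType} {d : nat}.
Implicit Types (f C : 'rV[R]_d -> R) (v : 'rV[R]_d).

(** The zero function is included because vanishing jumps must qualify also in
    dimension 0, where there is no nonzero translation. *)
Definition cylindrical C := polyhedral C /\
  ((forall x, C x = 0) \/
   exists2 u, u != 0 & forall x (t : R), C (x + t *: u) = C x).

(** The negation is the vertex condition, for functions instead of sets.  Near
    v a polyhedral set coincides with its tangent cone at v, so a local
    identity replaces the tangent cone, and invariance under a translation is
    all that matters about a line-cone. *)
Definition locally_cylindrical f v :=
  exists (m : nat) (C : 'I_m -> 'rV[R]_d -> R) s,
    (forall i, cylindrical (C i)) /\
    (forall x, near_side s v x -> off s x -> f x = \sum_(i < m) C i x).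

End Cylindrical.

Section Chart.
Context {R : realType} {d m : nat}.
Implicit Types (h k : 'cV[R]_d * R) (x u n : 'rV[R]_d) (y v : 'rV[R]_m).

(** y |-> p + y *m B parametrizes the hyperplane through p orthogonal to a, and
    C retracts its direction space onto the parameter space. *)
Definition hyperplane_chart (a : 'cV[R]_d)
    (B : 'M[R]_(m, d)) (C : 'M[R]_(d, m)) :=
  [/\ B *m C = 1%:M, B *m a = 0 & forall u, lin a u = 0 -> u *m C *m B = u].

Definition pull (p : 'rV[R]_d) (B : 'M[R]_(m, d)) h : 'cV[R]_m * R :=
  (B *m h.1, h.2 - lin h.1 p).

Lemma linM (a : 'cV[R]_d) (B : 'M[R]_(m, d)) y :
  lin a (y *m B) = lin (B *m a) y.
Proof. by rewrite /lin mulmxA. Qed.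

Lemma ev_pull p B h y : ev (pull p B h) y = ev h (p + y *m B).
Proof. by rewrite /ev /= linD linM; ring. Qed.

Lemma adapted_comp s (f : 'rV[R]_d -> R) p (B : 'M[R]_(m, d)) : adapted s f ->
  adapted [seq pull p B h | h <- s] (fun y => f (p + y *m B)).
Proof.
move=> sf y z yz; apply: sf => h hs.
by rewrite -!ev_pull; apply: yz; apply: map_f.
Qed.

Variables (a : 'cV[R]_d) (p : 'rV[R]_d) (B : 'M[R]_(m, d)) (C : 'M[R]_(d, m)).
Hypothesis aBC : hyperplane_chart a B C.

(** A form that is constant on the hyperplane is a multiple of the one defining
    it, here phrased through kernels. *)
Lemma chart_lin (k : 'cV[R]_d) u : B *m k = 0 -> lin a u = 0 -> lin k u = 0.
Proof.
have [_ _ aCB] := aBC.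
by move=> Bk /aCB <-; rewrite linM Bk lin0l.
Qed.

Lemma chart_normal_lin (k : 'cV[R]_d) n :
  B *m k = 0 -> k != 0 -> lin a n != 0 -> lin k n != 0.
Proof.
move=> Bk k0 an; apply: contra k0 => /eqP kn; apply/eqP/lin_eq0 => x.
have /(chart_lin Bk) : lin a (x - (lin a x / lin a n) *: n) = 0.
  by rewrite linB linZ divfK// subrr.
by rewrite linB linZ kn mulr0 subr0.
Qed.

(** The jump of a cylindrical function across a hyperplane is cylindrical in
    the hyperplane if the translation is parallel to it.  Otherwise there is
    no jump: moving along the translation crosses the hyperplane. *)
Lemma cylindrical_jump (K : 'rV[R]_d -> R) n : cylindrical K -> lin a n != 0 ->
  exists (K' : 'rV[R]_m -> R) s, cylindrical K' /\
    forall y, off s y -> jump K n (p + y *m B) = K' y.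
Proof.
move=> [[s sK] [K0|[u u0 Ku]]] an.
  exists (fun=> 0), [::]; split; first by split; [exact: polyhedral_cst|left].
  by move=> y _; rewrite /jump !(@dlimE _ _ _ _ _ 0) ?subr0//; exact: nearW.
have dlimK n' x t : dlim K n' (x + t *: u) = dlim K n' x.
  rewrite /dlim (_ : (fun e => _) = fun e : R => K (x + e *: n'))//.
  by apply/funext => e; rewrite addrAC Ku.
have [au|au] := eqVneq (lin a u) 0.
  exists (fun y => jump K n (p + y *m B)), [::]; split=> //; split.
    exists [seq pull p B h | h <- s].
    by apply: (@adapted_comp s (jump K n)); exact: adapted_jump.
  right; have [_ _ aCB] := aBC; exists (u *m C).
    by apply: contra u0 => /eqP uC; rewrite -(aCB u au) uC mul0mx.
  move=> y t; rewrite mulmxDl -scalemxAl aCB// addrA /jump.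
  by rewrite !dlimK.
exists (fun=> 0), [seq pull p B h | h <- s]; split.
  by split; [exact: polyhedral_cst|left].
move=> y ys; set x := p + y *m B.
(* The translation, rescaled, may replace the direction n'. *)
have dK n' : dlim K n' x = K x.
  transitivity (dlim K ((lin a n' / lin a u) *: u) x).
    apply: (adapted_dlim_eq sK) => h hs; rewrite /sgr2; case: eqVneq => // hx.
    congr Num.sg; apply/eqP; rewrite -subr_eq0 -linB; apply/eqP.
    apply: chart_lin; last by rewrite linB linZ divfK// subrr.
    apply: contrapT => /eqP Bh.
    have := ys _ (map_f (pull p B) hs) Bh.
    by rewrite ev_pull hx eqxx.
  by apply: dlimE; apply: nearW => e; rewrite scalerA Ku.
by rewrite /jump !dK subrr.
Qed.

(** By contraposition, vertices of the jump across a hyperplane are vertices of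
    f.  A local identity for f survives the passage to jumps at the points of
    the hyperplane that avoid the traces of the other exceptional hyperplanes:
    leaving such a point in a transversal direction avoids all of them. *)
Lemma locally_cylindrical_jump f n v : lin a n != 0 ->
  locally_cylindrical f (p + v *m B) ->
  locally_cylindrical (fun y => jump f n (p + y *m B)) v.
Proof.
move=> an [l [K [s [cK fK]]]].
have /boolp.choice[K' /boolp.choice[t Kt]] :=
  fun i => cylindrical_jump (cK i) an.
exists l, K', ([seq pull p B h | h <- s] ++ flatten [seq t i | i <- enum 'I_l]).
split=> [i|y yv yo]; first by have [] := Kt i.
have [yo1 yo2] := (off_cat _ _ _).1 yo.
have -> : \sum_(i < l) K' i y = \sum_(i < l) jump (K i) n (p + y *m B).
  apply: eq_bigr => i _; have [_ ->//] := Kt i.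
  apply: off_sub yo2 => h hi; apply/flattenP; exists (t i) => //.
  by apply: map_f; rewrite mem_enum.
have dK n' : lin a n' != 0 ->
    dlim f n' (p + y *m B) = \sum_(i < l) dlim (K i) n' (p + y *m B).
  move=> an'; apply: dlim_near_sum => [i|]; first by case: (cK i).
  have H1 : near_side s (p + v *m B) (p + y *m B).
    move=> h hs hv; rewrite -!ev_pull in hv *; apply: yv => //.
    by rewrite mem_cat map_f.
  have H2 : \forall e \near 0^'+, off s (p + y *m B + e *: n').
    apply: near_off => h hs h0 hy; apply: chart_normal_lin => //.
    apply: contrapT => /eqP Bh.
    have := yo1 _ (map_f (pull p B) hs) Bh.
    by rewrite ev_pull hy eqxx.
  by move: H2; apply: filterS2 (near_near_side n' H1) => e; exact: fK.
rewrite /jump !dK ?linN ?oppr_eq0// -sumrB.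
by [].
Qed.

End Chart.

Lemma hyperplane_chart_exists {R : realType} {d : nat} (a : 'cV[R]_d.+1) :
  a != 0 -> exists B C, @hyperplane_chart R d.+1 d a B C.
Proof.
move=> a0; have ra : \rank a = 1%N.
  apply/eqP; rewrite eqn_leq rank_leq_col/= lt0n mxrank_eq0//.
have rk : \rank (kermx a) = d by rewrite mxrank_ker ra subSS subn0.
have [B fB eB] : exists2 B : 'M[R]_(d, d.+1), row_free B & (B :=: kermx a)%MS.
  move: (row_base (kermx a)) (row_base_free (kermx a)) (eq_row_base (kermx a)).
  by rewrite rk => B; exists B.
exists B, (pinvmx B); split; first exact: mulmxVp.
  by apply/sub_kermxP; rewrite eB.
move=> u ua; apply: mulmxKpV; rewrite eB; apply/sub_kermxP.
by apply/matrixP => i j; rewrite !ord1 [RHS]mxE; exact: ua.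
Qed.

(** * The ray formula *)

Section StepFunctions.
Context {R : realType}.

Lemma seq_argmin (I : eqType) (r : seq I) (tau : I -> R) : r != [::] ->
  exists2 i, i \in r & forall k, k \in r -> tau i <= tau k.
Proof.
elim: r => [//|i r IH] _; have [->|/IH[j jr Hj]] := eqVneq r [::].
  by exists i; rewrite ?mem_head// => k; rewrite inE => /eqP->.
have [ij|ji] := lerP (tau i) (tau j).
  exists i; rewrite ?mem_head// => k; rewrite inE => /predU1P[->//|/Hj].
  exact: le_trans.
exists j; rewrite ?inE ?jr ?orbT// => k; rewrite inE => /predU1P[->|/Hj//].
exact: ltW.
Qed.

(** Telescoping, by induction on the number of break points beyond t: the value
    is constant up to the next break point, where it drops by the jump. *)
Lemma sum_of_jumps (I : eqType) (r : seq I) (tau j : I -> R) (G : R -> R) t :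
  uniq r -> {in r &, injective tau} ->
  (forall t t', 1 <= t -> t <= t' ->
     (forall i, i \in r -> ~ t <= tau i <= t') -> G t = G t') ->
  (forall i, i \in r -> 1 < tau i ->
     \forall e \near 0^'+, G (tau i - e) - G (tau i + e) = j i) ->
  (exists M, forall t, M <= t -> G t = 0) ->
  1 <= t -> (forall i, i \in r -> tau i != t) ->
  G t = \sum_(i <- r | t < tau i) j i.
Proof.
move=> ur itau G1 G2 [M GM].
have [N] := ubnP (size [seq i <- r | t < tau i]); elim: N t => // N IH t.
rewrite ltnS => sN t1 tt.
have [r0|/(@seq_argmin _ _ tau)[i]] := eqVneq [seq i <- r | t < tau i] [::].
  rewrite -big_filter r0 big_nil -(GM (Num.max t M)) ?le_max ?lexx ?orbT//.
  apply: G1; rewrite ?le_max ?lexx// => i ir; rewrite le_eqVlt => /andP[].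
  rewrite eq_sym (negbTE (tt i ir)) /= => ti _.
  have : i \in [seq i <- r | t < tau i] by rewrite mem_filter ti.
  by rewrite r0.
rewrite mem_filter => /andP[ti ir] imin.
have Hk : \forall e \near 0^'+,
    forall k, k \in r -> tau i < tau k -> tau i + e < tau k.
  apply: near_all => k _.
  have [ik|ik] := ltP (tau i) (tau k); last exact: nearW.
  near=> e => _; rewrite addrC -ltrBrDr; near: e.
  by apply: nbhs_right_lt; rewrite subr_gt0.
have ti0 : 0 < tau i - t by rewrite subr_gt0.
have Hj := G2 i ir (le_lt_trans t1 ti).
have [e [[e0 et] [ek ej]]] := filter_ex (filterI
  (filterI (nbhs_right_gt 0) (nbhs_right_lt ti0)) (filterI Hk Hj)).
have min_i k : k \in r -> t < tau k -> tau i <= tau k.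
  by move=> kr tk; apply: imin; rewrite mem_filter tk.
have PE k : k \in r -> (t < tau k) && (k != i) = (tau i + e < tau k).
  move=> kr; apply/idP/idP => [/andP[tk ki]|ik].
    apply: ek => //; rewrite lt_neqAle min_i// andbT.
    by apply: contra ki => /eqP/(itau _ _ ir kr) ->.
  apply/andP; split; first by lra.
  by apply/eqP => ki; move: ik; rewrite ki; lra.
rewrite -big_filter (bigD1_seq i) ?mem_filter ?ti ?filter_uniq//=.
rewrite big_filter_cond -ej (G1 t (tau i - e))//; last 2 first.
- by lra.
- move=> k kr /andP[tk ki].
  have tk' : t < tau k by rewrite lt_neqAle eq_sym tt.
  by have := min_i k kr tk'; lra.
rewrite (IH (tau i + e)).
- rewrite (_ : \sum_(k <- r | _ && _) _ =
    \sum_(k <- r | tau i + e < tau k) j k).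
    by rewrite subrK.
  rewrite big_seq_cond [RHS]big_seq_cond; apply: eq_bigl => k.
  by case: (boolP (k \in r)) => // kr; rewrite /= PE.
- apply: leq_trans sN.
  have us : uniq (i :: [seq k <- r | tau i + e < tau k]).
    rewrite /= filter_uniq// mem_filter andbT; apply/nandP; left.
    by rewrite -leNgt; lra.
  apply: (uniq_leq_size us) => k; rewrite inE mem_filter => /predU1P[->|].
    by rewrite mem_filter ti.
  by case/andP => ik kr; rewrite mem_filter kr andbT; lra.
- by lra.
- move=> k kr; have [ik|ik] := ltP (tau i) (tau k); last by lra.
  by have := ek k kr ik; lra.
Unshelve. all: by end_near. Qed.

End StepFunctions.

Section Rays.
Context {R : realType} {d : nat}.
Implicit Types (h k : 'cV[R]_d * R) (a : 'cV[R]_d) (x y u v : 'rV[R]_d).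
Implicit Types (s L : seq ('cV[R]_d * R)) (f g : 'rV[R]_d -> R).

(** Boundedness of the support, tested on linear forms so that it restricts to
    hyperplanes without comparing norms. *)
Definition bounded_support f :=
  forall a, exists M, forall x, f x != 0 -> `|lin a x| <= M.

(** No two of the forms are proportional.  The ray formula needs one term per
    hyperplane, whereas a description of f by forms may repeat hyperplanes. *)
Definition distinct_hyperplanes L :=
  [/\ uniq L, forall h, h \in L -> h.1 != 0 &
      forall h k (c : R), h \in L -> k \in L ->
        k.1 = c *: h.1 -> k.2 = c * h.2 -> h = k].

Lemma ev_proportional h k (c : R) x :
  k.1 = c *: h.1 -> k.2 = c * h.2 -> ev k x = c * ev h x.
Proof. by rewrite /ev => -> ->; rewrite linZl mulrBr. Qed.

Lemma distinct_hyperplanes_exist s : exists2 L, distinct_hyperplanes L &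
  forall x y, same_side L x y -> same_side s x y.
Proof.
elim: s => [|h s [L [uL L0 LL] sL]]; first by exists [::].
have red : (forall x y, same_side L x y -> Num.sg (ev h x) = Num.sg (ev h y)) ->
    exists2 L, distinct_hyperplanes L &
    forall x y, same_side L x y -> same_side (h :: s) x y.
  move=> H; exists L => // x y xy k.
  by rewrite inE => /predU1P[->|]; [exact: H|exact: sL].
have [h0|h0] := eqVneq h.1 0.
  by apply: red => x y _; rewrite (ev_const x y h0).
have [[k [c [kL h1 h2]]]|nk] := pselect (exists k c,
    [/\ k \in L, h.1 = c *: k.1 & h.2 = c * k.2]).
  apply: red => x y xy.
  by rewrite !(ev_proportional _ h1 h2) !sgrM (xy k kL).
exists (h :: L).
  split=> [|k|k l c].
  - rewrite /= uL andbT; apply/negP => hL; apply: nk; exists h, 1.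
    by rewrite scale1r mul1r.
  - by rewrite inE => /predU1P[->|/L0].
  rewrite !inE => /predU1P[->|kL] /predU1P[->|lL] // e1 e2.
  - exfalso; apply: nk; exists l, c^-1.
    have c0 : c != 0.
      by apply: contraNneq (L0 l lL) => c0; rewrite e1 c0 scale0r.
    by rewrite e1 e2 scalerA mulrA mulVf// scale1r mul1r.
  - by exfalso; apply: nk; exists k, c.
  - exact: LL e1 e2.
move=> x y xy k; rewrite inE => /predU1P[->|].
  by apply: xy; rewrite mem_head.
by apply: sL => l lL; apply: xy; rewrite inE lL orbT.
Qed.

Lemma polyhedral_distinct f : polyhedral f ->
  exists2 L, distinct_hyperplanes L & adapted L f.
Proof.
move=> [s sf]; have [L dL sL] := distinct_hyperplanes_exist s.
by exists L => // x y /sL; exact: sf.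
Qed.

Variable w : 'rV[R]_d.

(** The ray from w through x is at time 0 in w and at time 1 in x; it meets
    the hyperplane of h at time hit_time h x. *)
Definition hit_time h x : R := ev h w / (ev h w - ev h x).
Definition hit h x : 'rV[R]_d := w + hit_time h x *: (x - w).

(** The form vanishing on the hyperplane that w spans with the intersection of
    the hyperplanes of h and k. *)
Definition span_form h k : 'cV[R]_d * R :=
  (ev h w *: k.1 - ev k w *: h.1, ev h w * k.2 - ev k w * h.2).

(** The form vanishing on the parallel through w to the hyperplane of h; off it,
    the line through w and x meets the hyperplane of h. *)
Definition parallel_form h : 'cV[R]_d * R := (h.1, h.2 + ev h w).

Lemma ev_parallel_form h x : ev (parallel_form h) x = ev h x - ev h w.
Proof. by rewrite /ev /= /ev; ring. Qed.

Lemma ev_ray h x (t : R) :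
  ev h (w + t *: (x - w)) = ev h w + t * (ev h x - ev h w).
Proof. by rewrite evD linZ linB /ev; ring. Qed.

Lemma ev_span_form h k x :
  ev (span_form h k) x = ev h w * ev k x - ev k w * ev h x.
Proof. by rewrite /span_form /ev /= linBl !linZl; ring. Qed.

Lemma ev_hit h k x : ev h w - ev h x != 0 ->
  (ev h w - ev h x) * ev k (hit h x) = ev (span_form h k) x.
Proof. by move=> D0; rewrite ev_span_form ev_ray /hit_time; field. Qed.

Lemma hit_on h x : ev h w - ev h x != 0 -> ev h (hit h x) = 0.
Proof.
by move=> D0; apply: (mulfI D0); rewrite ev_hit// ev_span_form mulr0 subrr.
Qed.

Lemma span_form_neq0 L h k : distinct_hyperplanes L -> h \in L -> k \in L ->
  ev h w != 0 -> h != k -> (span_form h k).1 != 0.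
Proof.
move=> [_ _ LL] hL kL hw; apply: contra => /=; rewrite subr_eq0 => /eqP e1.
apply/eqP; apply: (LL h k (ev k w / ev h w)) => //.
  by rewrite mulrC -scalerA -e1 scalerA mulVf// scale1r.
apply: (mulfI hw).
have -> : ev h w * (ev k w / ev h w * h.2) = ev k w * h.2 by field.
have : ev h w * lin k.1 w = ev k w * lin h.1 w by rewrite -!linZl e1.
by rewrite /ev; lra.
Qed.

(** For generic x the ray from w through x meets the hyperplanes one at a time,
    so f x is the telescoping sum of the jumps met after time 1. *)
Lemma ray_formula L f (a : 'cV[R]_d) : a != 0 ->
  distinct_hyperplanes L -> adapted L f -> bounded_support f ->
  exists s, forall x, off s x ->
    f x = \sum_(h <- L | (ev h w != 0) && (1 < hit_time h x))
            jump f (x - w) (hit h x).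
Proof.
move=> a0 dL Lf bf; have [uL L0 LL] := dL.
(* The form (a, lin a w) only serves to exclude x = w; the span forms exclude
   simultaneous hits of two hyperplanes. *)
exists ((a, lin a w) :: L ++ [seq parallel_form h | h <- L] ++
   [seq span_form h k | h <- L, k <- L]) => x.
move=> /off_cons[/(_ a0)]; rewrite {1}/ev /= -linB => ax.
move=> /off_cat[xL /off_cat[xp xs]].
have D0 h : h \in L -> ev h x - ev h w != 0.
  by move=> hL; have := xp _ (map_f _ hL) (L0 h hL); rewrite ev_parallel_form.
have D0' h : h \in L -> ev h w - ev h x != 0.
  by move=> /D0; rewrite -oppr_eq0 opprB.
have rayE h (t : R) : h \in L -> ev h (w + t *: (x - w)) =
    (ev h x - ev h w) * (t - hit_time h x).
  by move=> hL; rewrite ev_ray /hit_time; field; exact: D0'.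
rewrite -[LHS](_ : f (w + 1 *: (x - w)) = _); last first.
  by rewrite scale1r addrC subrK.
rewrite -big_filter_cond.
apply: (@sum_of_jumps R _ [seq h <- L | ev h w != 0] (fun h => hit_time h x)
  (fun h => jump f (x - w) (hit h x)) (fun t => f (w + t *: (x - w))) 1) => //.
- exact: filter_uniq.
- move=> h k; rewrite !mem_filter => /andP[hw hL] /andP[kw kL] hk.
  apply: contrapT => /eqP nhk.
  have := xs _ (allpairs_f _ hL kL) (span_form_neq0 dL hL kL hw nhk).
  rewrite -ev_hit ?D0'// /hit hk -/(hit k x) hit_on ?D0'//.
  by rewrite mulr0 eqxx.
- move=> t t' t1 tt' H; apply: Lf => h hL; rewrite !rayE// !sgrM; congr (_ * _).
  have [hw|hw] := eqVneq (ev h w) 0.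
    rewrite /hit_time hw mul0r !subr0 !gtr0_sg//; lra.
  have := H h; rewrite mem_filter hw hL => /(_ isT) /negP.
  rewrite negb_and -!ltNge => /orP[K|K].
    by rewrite !gtr0_sg// subr_gt0//; lra.
  by rewrite !ltr0_sg// subr_lt0//; lra.
- move=> h; rewrite mem_filter => /andP[hw hL] _.
  have pf : polyhedral f by exists L.
  have H1 := polyhedral_dlimP (- (x - w)) (hit h x) pf.
  have H2 := polyhedral_dlimP (x - w) (hit h x) pf.
  apply: filterS2 H1 H2 => e E1 E2; rewrite /jump -E1 -E2 /hit.
  by rewrite scalerN scalerBl scalerDl !addrA.
- have [M HM] := bf a; exists ((M + `|lin a w|) / `|lin a (x - w)| + 1) => t tM.
  apply: contrapT => /eqP /HM; apply/negP; rewrite -ltNge.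
  have l0 : 0 < `|lin a (x - w)| by rewrite normr_gt0.
  have H1 : M + `|lin a w| < t * `|lin a (x - w)|.
    by rewrite -ltr_pdivrMr//; lra.
  have H2 : t * `|lin a (x - w)| <= `|t * lin a (x - w)|.
    by rewrite normrM ler_wpM2r// ler_norm.
  rewrite linD linZ; have := lerB_normD (t * lin a (x - w)) (lin a w).
  by rewrite (addrC (lin a w)); lra.
- move=> h; rewrite mem_filter => /andP[hw hL].
  apply: contraNneq (xL h hL (L0 h hL)) => t1.
  have := rayE h 1 hL; rewrite t1 subrr mulr0 scale1r addrC subrK => ->.
  by [].
Qed.

End Rays.

(** * Cones over facets and the simplicial decomposition *)

Section FacetCones.
Context {R : realType} {d m : nat}.
Implicit Types (x y z : 'rV[R]_d) (v : 'rV[R]_m).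
Variables (h : 'cV[R]_d * R) (p w : 'rV[R]_d).
Variables (B : 'M[R]_(m, d)) (C : 'M[R]_(d, m)).
Hypothesis hBC : hyperplane_chart h.1 B C.
Hypotheses (hp : ev h p = 0) (hw : ev h w != 0).

Definition cone_over (S : {fset 'rV[R]_m}) : {fset 'rV[R]_d} :=
  (w |` [fset (p + v *m B)%R | v in S])%fset.

Let BC : B *m C = 1%:M. Proof. by case: hBC. Qed.
Let Bh : B *m h.1 = 0. Proof. by case: hBC. Qed.

Lemma chartK v : (p + v *m B - p) *m C = v.
Proof. by rewrite addrAC subrr add0r -mulmxA BC mulmx1. Qed.

Lemma chart_ev v : ev h (p + v *m B) = 0.
Proof. by rewrite evD hp linM Bh lin0l addr0. Qed.

Lemma retractK x : ev h x = 0 -> p + (x - p) *m C *m B = x.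
Proof.
have [_ _ hCB] := hBC; move=> hx; rewrite hCB; first by rewrite addrC subrK.
by rewrite linB; move: hx hp; rewrite /ev; lra.
Qed.

Lemma chart_in_cone_over (S : {fset 'rV[R]_m}) v :
  v \in S -> p + v *m B \in cone_over S.
Proof. by move=> vS; apply/fset1Ur/imfsetP; exists v. Qed.

Lemma sum_cone_over (V : nmodType) (S : {fset 'rV[R]_m}) (F : 'rV[R]_d -> V) :
  \sum_(z <- cone_over S) F z = F w + \sum_(v <- S) F (p + v *m B).
Proof.
rewrite big_fsetU1/=; last first.
  by apply/imfsetP => -[v _ wv]; move: hw; rewrite wv chart_ev eqxx.
rewrite big_imfset//= => v1 v2 _ _ e.
by rewrite -(chartK v1) e chartK.
Qed.

Lemma sum_chart (S : {fset 'rV[R]_m}) (c : 'rV[R]_m -> R) :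
  \sum_(v <- S) c v *: (p + v *m B) =
  (\sum_(v <- S) c v) *: p + (\sum_(v <- S) c v *: v) *m B.
Proof.
rewrite scaler_suml mulmx_suml -big_split/=.
by apply: eq_bigr => v _; rewrite scalerDr scalemxAl.
Qed.

(** The form h vanishes on S and not at w, so in an affine relation the
    coefficient of w is zero. *)
Lemma simplex_cone_over (S : {fset 'rV[R]_m}) :
  simplex S -> simplex (cone_over S).
Proof.
move=> [S0 aS]; split.
  by apply/fset0Pn; exists w; rewrite fset1U1.
move=> c; rewrite !sum_cone_over sum_chart => c1 c2.
have cw : c w = 0.
  apply: (mulIf hw); rewrite mul0r.
  have := congr1 (lin h.1) c2.
  rewrite lin0 !linD !linZ linM Bh lin0l addr0.
  have : lin h.1 p = h.2 by move: hp; rewrite /ev; lra.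
  have -> : \sum_(v <- S) c (p + v *m B) = - c w by move: c1; lra.
  by rewrite /ev => ->; lra.
move: c1 c2; rewrite cw scale0r !add0r => c1; rewrite c1 scale0r add0r => c2.
have c3 : \sum_(v <- S) c (p + v *m B) *: v = 0.
  by rewrite -[LHS]mulmx1 -BC mulmxA c2 mul0mx.
move=> v; rewrite !inE => /orP[/eqP->//|/imfsetP[u /= uS ->]].
exact: (aS (fun u => c (p + u *m B))).
Qed.

(** If x = (1 - mu) w + mu y with y in the hyperplane, then y is the point hit
    by the ray from w through x, and the hitting time is 1 / mu. *)
Lemma conv_hull_cone_over (S : {fset 'rV[R]_m}) x :
  ev h w - ev h x != 0 -> ev h x != 0 ->
  conv_hull (cone_over S) x <->
  1 < hit_time w h x /\ conv_hull S ((hit w h x - p) *m C).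
Proof.
move=> D0 hx; split=> [[c [c0 c1 xE]]|[t1 [c [c0 c1 yE]]]].
  move: c1 xE; rewrite !sum_cone_over sum_chart.
  set mu := \sum_(v <- S) c _; set X := \sum_(v <- S) c _ *: v => c1 xE.
  have cw : c w = 1 - mu by lra.
  have hxE : ev h x = (1 - mu) * ev h w.
    rewrite /ev xE !linD !linZ linM Bh lin0l -cw.
    have -> : lin h.1 p = h.2 by move: hp; rewrite /ev; lra.
    by rewrite cw; ring.
  have DE : ev h w - ev h x = mu * ev h w by rewrite hxE; ring.
  have mu0 : mu != 0 by apply: contraNneq D0 => mu0; rewrite DE mu0 mul0r.
  have cw0 : c w != 0 by apply: contraNneq hx => e; rewrite hxE -cw e mul0r.
  have cw1 : 0 <= c w by apply: c0; rewrite fset1U1.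
  have mu1 : 0 <= mu.
    rewrite /mu big_seq; apply: sumr_ge0 => v vS; apply: c0.
    exact: chart_in_cone_over.
  have mup : 0 < mu by rewrite lt_neqAle eq_sym mu0.
  have cwp : 0 < c w by rewrite lt_neqAle eq_sym cw0.
  have tE : hit_time w h x = mu^-1.
    by rewrite /hit_time DE; field; rewrite mu0 hw.
  rewrite tE invf_gt1//; split; first by lra.
  exists (fun v => mu^-1 * c (p + v *m B)); split.
  - move=> v vS; rewrite mulr_ge0// ?invr_ge0//; apply: c0.
    exact: chart_in_cone_over.
  - by rewrite -mulr_sumr mulVf.
  - rewrite /hit tE xE cw.
    have -> (Y : 'rV[R]_d) :
        w + mu^-1 *: ((1 - mu) *: w + (mu *: p + Y) - w) - p = mu^-1 *: Y.
      by apply/rowP => i; rewrite !mxE; field.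
    rewrite -scalemxAl -mulmxA BC mulmx1 scaler_sumr; apply: eq_bigr => v _.
    by rewrite scalerA.
set t := hit_time w h x in t1 *.
have t0 : 0 < t by lra.
exists (fun z => if z == w then 1 - t^-1 else t^-1 * c ((z - p) *m C)).
have phiw v : (p + v *m B == w) = false.
  by apply: contra_neqF hw => /eqP <-; rewrite chart_ev.
split.
- move=> z; rewrite inE; case: eqVneq => [_ _|zw].
    by rewrite subr_ge0 invf_le1// ltW.
  rewrite inE (negbTE zw) => /imfsetP[v /= vS ->]; rewrite chartK.
  by rewrite mulr_ge0 ?invr_ge0 ?(ltW t0)// c0.
- rewrite sum_cone_over eqxx.
  under eq_bigr do rewrite phiw chartK.
  by rewrite -mulr_sumr c1; ring.
- rewrite sum_cone_over eqxx.
  under eq_bigr do rewrite phiw chartK -scalerA.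
  rewrite -scaler_sumr sum_chart c1 scale1r -yE retractK; last exact: hit_on.
  rewrite /hit -/t; apply/rowP => i; rewrite !mxE.
  by field; rewrite gt_eqF.
Qed.

(** The extension of an affine form from the hyperplane, along the chart. *)
Definition push (k : 'cV[R]_m * R) : 'cV[R]_d * R :=
  (C *m k.1, k.2 + lin k.1 (p *m C)).

Lemma ev_push (k : 'cV[R]_m * R) x : ev (push k) x = ev k ((x - p) *m C).
Proof. by rewrite /ev /= -linM mulmxBl linB; ring. Qed.

Lemma sgr2_proportional (c a b : R) : 0 < a * b -> sgr2 c a = sgr2 c b.
Proof.
move=> ab; rewrite /sgr2; case: eqVneq => // _.
have [a0|a0|a0] := ltgtP a 0; last by move: ab; rewrite a0 mul0r ltxx.
  by rewrite !ltr0_sg// -(nmulr_rgt0 _ a0).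
by rewrite !gtr0_sg// -(pmulr_rgt0 _ a0).
Qed.

(** A simplicial decomposition of the jump across the hyperplane of h, coned
    from w, is the contribution of this hyperplane to the ray formula.  The
    jump may be taken in any transversal direction: at a generic point of the
    hyperplane no other hyperplane of L is met. *)
Lemma facet_contribution (L : seq ('cV[R]_d * R)) (f : 'rV[R]_d -> R)
    (t : seq ('cV[R]_m * R)) (l : seq (int * {fset 'rV[R]_m})) :
  distinct_hyperplanes L -> h \in L -> adapted L f ->
  (forall v, off t v -> jump f (p - w) (p + v *m B) =
     \sum_(q <- l) q.1%:~R * \1_(conv_hull q.2) v) ->
  exists s, forall x, off s x ->
    \sum_(q <- l) q.1%:~R * \1_(conv_hull (cone_over q.2)) x =
    if 1 < hit_time w h x then jump f (x - w) (hit w h x) else 0.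
Proof.
move=> dL hL Lf tl; have [_ L0 _] := dL.
exists (h :: parallel_form w h :: [seq span_form w h k | k <- L] ++
  [seq span_form w h (push k) | k <- t]) => x.
move=> /off_cons[/(_ (L0 h hL)) hx] /off_cons[/(_ (L0 h hL))].
rewrite ev_parallel_form -oppr_eq0 opprB => D0 /off_cat[sL st].
set y := (hit w h x - p) *m C.
have hitE : p + y *m B = hit w h x by rewrite /y retractK// hit_on.
(* The exceptional hyperplanes t inside the hyperplane of h are avoided by y
   because x avoids the hyperplanes they span with w. *)
have yt : off t y.
  move=> k kt k0; rewrite /y -ev_push.
  suff : ev (span_form w h (push k)) x != 0.
    by apply: contraNneq => e; rewrite -ev_hit// e mulr0.
  apply: st; first exact: (map_f (fun k => span_form w h (push k))).
  apply: contra k0 => /eqP /= e.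
  have := congr1 (mulmx B) e.
  rewrite mulmxBr -!scalemxAr mulmxA BC mul1mx Bh scaler0 subr0 mulmx0 => /eqP.
  by rewrite scaler_eq0 (negbTE hw).
have cE q : \1_(conv_hull (cone_over q.2)) x =
    if 1 < hit_time w h x then \1_(conv_hull q.2) y else 0 :> R.
  have cP := @conv_hull_cone_over q.2 x D0 hx.
  rewrite !indicE; case: ifPn => t1.
    congr ((nat_of_bool _)%:R); apply/idP/idP => /set_mem H; apply/mem_set.
      by have [] := cP.1 H.
    exact: cP.2 (conj t1 H).
  by rewrite memNset// => H; have [t2 _] := cP.1 H; rewrite t2 in t1.
under eq_bigr do rewrite cE.
case: ifPn => t1; last by rewrite big1// => q _; rewrite mulr0.
rewrite -tl// hitE.
have D1 : 0 < ev h w * (ev h w - ev h x).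
  have := t1; rewrite /hit_time => /(lt_trans ltr01).
  have D2 : 0 < (ev h w - ev h x) ^+ 2 by rewrite exprn_even_gt0.
  by rewrite -(pmulr_lgt0 _ D2) expr2 mulrA divfK// mulrC.
have Ldir k : k \in L -> ev k (hit w h x) = 0 -> k = h.
  move=> kL; apply: contraPeq => kh; apply/eqP.
  suff : ev (span_form w h k) x != 0.
    by apply: contraNneq => e; rewrite -ev_hit// e mulr0.
  apply: sL; first exact: map_f.
  by apply: span_form_neq0 dL hL kL hw _; rewrite eq_sym.
have hd : 0 < lin h.1 (p - w) * lin h.1 (x - w).
  move: D1 hp; rewrite !linB /ev => D1 hp'.
  by rewrite (_ : lin h.1 p = h.2); lra.
by rewrite /jump; congr (_ - _); apply: (adapted_dlim_eq Lf) => k kL;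
  (have [/(Ldir k kL)->|kx] := eqVneq (ev k (hit w h x)) 0;
   last by rewrite /sgr2 (negbTE kx));
  apply: sgr2_proportional; rewrite ?linN ?mulrNN.
Qed.

End FacetCones.

Section Decomposition.
Context {R : realType}.

Lemma polyhedral_dlim_val d (f : 'rV[R]_d -> R) n x : polyhedral f ->
  exists2 e : R, 0 < e <= 1 & dlim f n x = f (x + e *: n).
Proof.
move=> pf; have [e [[e0 e1] e2]] := filter_ex (filterI
  (filterI (nbhs_right_gt 0) (nbhs_right_le (@ltr01 R)))
  (polyhedral_dlimP n x pf)).
by exists e => //; apply/andP; split.
Qed.

Lemma bounded_support_jump d m (f : 'rV[R]_d -> R) n p
    (B : 'M[R]_(m, d)) (C : 'M[R]_(d, m)) :
  B *m C = 1%:M -> polyhedral f -> bounded_support f ->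
  bounded_support (fun v => jump f n (p + v *m B)).
Proof.
move=> BC pf bf a; have [M HM] := bf (C *m a).
exists (M + `|lin (C *m a) p| + `|lin (C *m a) n|) => v J0.
have aE : lin a v = lin (C *m a) (v *m B) by rewrite linM mulmxA BC mul1mx.
have [e e1 fe] : exists2 e : R, `|e| <= 1 & f (p + v *m B + e *: n) != 0.
  have [e1 /andP[e1p e1l] E1] := polyhedral_dlim_val (- n) (p + v *m B) pf.
  have [e2 /andP[e2p e2l] E2] := polyhedral_dlim_val n (p + v *m B) pf.
  have [f2|f2] := eqVneq (f (p + v *m B + e2 *: n)) 0; last first.
    by exists e2 => //; rewrite gtr0_norm.
  exists (- e1); first by rewrite normrN gtr0_norm.
  by move: J0; rewrite /jump E1 E2 f2 subr0 scalerN scaleNr.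
have := HM _ fe; rewrite !linD linZ -aE.
set P := lin _ p; set N := lin _ n => H.
have eN : `|e * N| <= `|N| by rewrite normrM ler_piMl.
have -> : lin a v = (P + lin a v + e * N) - (P + e * N) by ring.
apply: le_trans (ler_normB _ _) _; have := ler_normD P (e * N); lra.
Qed.

(** Induction on the dimension.  By the ray formula f is the sum, over the
    hyperplanes where it jumps, of the cones from w over the jumps, and these
    live in dimension one less.  Their vertices are vertices of f, so choosing
    a vertex of f as w keeps all vertices of the cones among those of f; if f
    has no vertex then neither have its jumps, and all sums are empty. *)
Theorem simplicial_decomposition d (f : 'rV[R]_d -> R) :
  polyhedral f -> bounded_support f ->
  (forall x, exists z : int, f x = z%:~R) ->
  exists (l : seq (int * {fset 'rV[R]_d})) s,
    (forall q, q \in l -> simplex q.2 /\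
       forall v, v \in q.2 -> ~ locally_cylindrical f v) /\
    (forall x, off s x -> f x = \sum_(q <- l) q.1%:~R * \1_(conv_hull q.2) x).
Proof.
elim: d f => [|d IH] f pf bf zf.
  have all0 (x : 'rV[R]_0) : x = 0 by apply/matrixP => i [].
  have [z fz] := zf 0.
  have [z0|z0] := eqVneq z 0.
    exists [::], [::]; split=> // x _.
    by rewrite big_nil (all0 x) fz z0.
  exists [:: (z, [fset 0]%fset)], [::]; split=> [q|x _].
    rewrite inE => /eqP-> /=; split.
      split; first by apply/fset0Pn; exists 0; rewrite inE.
      by move=> c; rewrite !big_seq_fset1 => c0 _ v; rewrite inE => /eqP->.
    move=> v _ [n [K [s [cK fK]]]]; move: z0; rewrite -(intr_eq0 R) -fz.
    rewrite fK; first (rewrite big1 ?eqxx// => i _).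
    - have [_ [->//|[u]]] := cK i.
      by rewrite (all0 u) eqxx.
    - by move=> h _; rewrite (all0 v).
    - by move=> h _; rewrite (_ : h.1 = 0) ?eqxx//; apply/matrixP => -[].
  rewrite big_seq1/= (all0 x) fz indicE mem_set ?mulr1//.
  by exists (fun=> 1); split=> //; rewrite big_seq_fset1 ?scale1r.
have [L dL Lf] := polyhedral_distinct pf.
(* A vertex of f, if there is any. *)
have [w wV] : exists w, forall v, ~ locally_cylindrical f v ->
    ~ locally_cylindrical f w.
  have [[w wV]|nV] := pselect (exists w, ~ locally_cylindrical f w).
    by exists w.
  by exists 0 => v vV; exfalso; apply: nV; exists v.
have facet (h : 'cV[R]_d.+1 * R) :
    exists (l : seq (int * {fset 'rV[R]_d.+1})) s,
    h \in L -> ev h w != 0 ->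
    (forall q, q \in l -> simplex q.2 /\
       forall v, v \in q.2 -> ~ locally_cylindrical f v) /\
    forall x, off s x -> \sum_(q <- l) q.1%:~R * \1_(conv_hull q.2) x =
      if 1 < hit_time w h x then jump f (x - w) (hit w h x) else 0.
  have [[hL hw]|nh] := pselect (h \in L /\ ev h w != 0); last first.
    by exists [::], [::] => hL hw; exfalso; apply: nh.
  have [_ L0 _] := dL.
  have [B [C hBC]] := hyperplane_chart_exists (L0 h hL).
  have [BC Bh hCB] := hBC.
  have [p hp] : exists p, ev h p = 0.
    have [x hx] := lin_neq0 (L0 h hL); exists ((h.2 / lin h.1 x) *: x).
    by rewrite /ev linZ divfK// subrr.
  have hn : lin h.1 (p - w) != 0.
    apply: contraNneq hw; rewrite linB; move: hp; rewrite /ev => hp e.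
    by apply/eqP; lra.
  have [||z|l [t [lV lE]]] := IH (fun v => jump f (p - w) (p + v *m B)).
  - exists [seq pull p B k | k <- L].
    by apply: (@adapted_comp _ _ _ L (jump f (p - w))); exact: adapted_jump.
  - exact: bounded_support_jump BC pf bf.
  - have [e1 _ E1] := polyhedral_dlim_val (- (p - w)) (p + z *m B) pf.
    have [e2 _ E2] := polyhedral_dlim_val (p - w) (p + z *m B) pf.
    rewrite /jump E1 E2.
    have [z1 ->] := zf (p + z *m B + e1 *: - (p - w)).
    have [z2 ->] := zf (p + z *m B + e2 *: (p - w)).
    by exists (z1 - z2); rewrite intrB.
  have [s sE] := facet_contribution hBC hp hw dL hL Lf lE.
  exists [seq (q.1, cone_over p w B q.2) | q <- l], s => _ _; split; last first.
    by move=> x /sE <-; rewrite big_map.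
  move=> _ /mapP[q ql ->] /=; have [qs qV] := lV q ql.
  split; first exact: (simplex_cone_over hBC hp hw).
  have phiV v : v \in q.2 -> ~ locally_cylindrical f (p + v *m B).
    by move=> /qV vV K; exact: (vV (locally_cylindrical_jump hBC hn K)).
  move=> v; rewrite !inE => /orP[/eqP->|/imfsetP[u /= uq ->]]; last exact: phiV.
  (* A vertex of the jump certifies that f has a vertex, hence that w is one. *)
  have /fset0Pn[u uq] : q.2 != fset0 by case: qs.
  exact: wV (phiV u uq).
have [l /boolp.choice[s ls]] := boolp.choice facet.
have [a a0] : exists a : 'cV[R]_d.+1, a != 0.
  exists (delta_mx 0 0); apply/eqP => /matrixP/(_ 0 0).
  by rewrite !mxE !eqxx => /eqP; rewrite oner_eq0.
have [s0 s0E] := ray_formula w a0 dL Lf bf.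
pose L' := [seq h <- L | ev h w != 0].
exists (flatten [seq l h | h <- L']), (s0 ++ flatten [seq s h | h <- L']).
split=> [q /flattenP[_ /mapP[h + ->]]|x].
  by rewrite mem_filter => /andP[hw hL] ql; have [+ _] := ls h hL hw; apply.
move=> /off_cat[/s0E -> xs].
rewrite big_flatten big_map big_filter big_mkcondr/=.
rewrite big_seq_cond [RHS]big_seq_cond; apply: eq_bigr => h /andP[hL hw].
have [_ ->//] := ls h hL hw.
apply: off_sub xs => k ks; apply/flattenP; exists (s h) => //.
by apply: map_f; rewrite mem_filter hw.
Qed.

End Decomposition.

(** * Null sets *)

Section BoxVolume.
Context {R : realType}.

(** Countable subadditivity of the volume of boxes, by slicing: for each value
    t of the last coordinate the slices at t of the covering boxes cover the
    slice of the box, and the induction hypothesis is integrated over t. *)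
Lemma box_cover_volume (d : nat) (D : set nat) (a b : nat -> R)
    (A B : nat -> nat -> R) :
  (forall i : 'I_d, a i <= b i) ->
  (forall k (i : 'I_d), A k i <= B k i) ->
  (forall x : nat -> R, (forall i : 'I_d, a i <= x i <= b i) ->
     exists2 k, D k & forall i : 'I_d, A k i <= x i <= B k i) ->
  ((\prod_(i < d) (b i - a i))%:E <=
   \esum_(k in D) (\prod_(i < d) (B k i - A k i))%:E)%E.
Proof.
elim: d D => [|d IH] D ab AB cover.
  rewrite big_ord0; have [|k Dk _] := cover (fun=> 0); first by case.
  apply: esum_ge; exists [set k].
    by split; [exact: finite_set1|move=> _ ->].
  by rewrite fsbig_set1 big_ord0.
pose W i : 'I_d.+1 := widen_ord (leqnSn d) i.
pose V k := \prod_(i < d) (B k i - A k i).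
have V0 k : 0 <= V k.
  by apply: prodr_ge0 => i _; rewrite subr_ge0; exact: (AB k (W i)).
pose I k : set R := `[A k d, B k d]%classic.
pose c k : R := if k \in D then V k else 0.
have c0 k : 0 <= c k by rewrite /c; case: ifP.
pose F k t : \bar R := ((c k)%:E * (\1_(I k) t)%:E)%E.
have F0 k t : (0 <= F k t)%E by rewrite mule_ge0// lee_fin.
pose v := \prod_(i < d) (b i - a i).
have slice t : `[a d, b d]%classic t -> (v%:E <= \sum_(k <oo) F k t)%E.
  rewrite /= in_itv/= => td.
  rewrite nneseries_esumT//.
  have -> : \esum_(k in [set: nat]) F k t =
      \esum_(k in D `&` [set k | I k t]) (V k)%:E.
    rewrite [RHS]esum_mkcond; apply: eq_esum => k _; rewrite /F /c indicE.
    rewrite in_setI; case: (k \in D) => /=; last by rewrite mul0e.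
    have [It|It] := pselect (I k t); first by rewrite !mem_set// mule1.
    by rewrite !memNset// mule0.
  apply: IH => [i|k i|x xab].
  - exact: ab (W i).
  - exact: AB k (W i).
  have [|k Dk xk] := cover (fun i => if i == d then t else x i).
    move=> i; case: eqVneq => [->//|id].
    have id' : (i < d)%N by rewrite ltn_neqAle id -ltnS ltn_ord.
    exact: (xab (Ordinal id')).
  exists k.
    by split=> //=; rewrite /I/= in_itv/=; have := xk ord_max; rewrite eqxx.
  by move=> i; have := xk (W i); rewrite /= (ltn_eqF (ltn_ord i)).
have mI (x y : R) : measurable (`[x, y]%classic : set R).
  exact: measurable_itv.
have mF k D' : measurable_fun D' (F k).
  apply: measurable_funeM; apply/measurable_EFinP.
  apply: measurable_indic; exact: mI.
have lenE (x y : R) : x <= y ->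
    lebesgue_measure (`[x, y]%classic : set R) = (y - x)%:E.
  rewrite lebesgue_measure_itv /= lte_fin le_eqVlt => /predU1P[->|->//].
  by rewrite ltxx subrr.
rewrite big_ord_recr /= EFinM -lenE; last exact: ab ord_max.
rewrite -(@integral_cst _ _ R lebesgue_measure _ (mI _ _)).
apply: (@le_trans _ _
  (\int[lebesgue_measure]_(t in `[a d, b d]) \sum_(k <oo) F k t)%E).
  apply: ge0_le_integral => //.
  - move=> t _; rewrite lee_fin; apply: prodr_ge0 => i _.
    by rewrite subr_ge0 (ab (W i)).
  - apply: (@ge0_emeasurable_sum _ _ _ _ F xpredT) => k *; first exact: F0.
    exact: mF.
rewrite integral_nneseries//; last by move=> k; exact: mF.
rewrite esum_mkcond -nneseries_esumT; last first.
  move=> k; case: ifP => // _; rewrite lee_fin; apply: prodr_ge0 => i _.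
  by rewrite subr_ge0.
apply: lee_nneseries => [k _ _|k _]; first exact: integral_ge0.
rewrite ge0_integralZl_EFin//; last first.
  by apply/measurable_EFinP; apply: measurable_indic; exact: mI.
rewrite integral_indic//; last exact: mI.
rewrite big_ord_recr/= -/(V k).
have -> : (if k \in D then (V k * (B k d - A k d))%:E else 0)%E =
    ((c k)%:E * (B k d - A k d)%:E)%E.
  by rewrite /c; case: ifP => // _; rewrite mul0e.
rewrite lee_wpmul2l ?lee_fin// -lenE; last exact: AB k ord_max.
apply: le_measure; rewrite ?inE; [|exact: mI|exact: subIsetl].
by apply: measurableI; exact: mI.
Qed.

End BoxVolume.

Section NullSets.
Context {R : realType} {d : nat}.
Implicit Types (S T : set 'rV[R]_d) (h : 'cV[R]_d * R) (x y : 'rV[R]_d).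

Lemma lebesgue_null_sub S T : S `<=` T -> lebesgue_null T -> lebesgue_null S.
Proof.
move=> ST nT e /nT[D [a [b [ab cov le]]]]; exists D, a, b; split=> //.
exact: subset_trans cov.
Qed.

Lemma not_null_box (a b : 'rV[R]_d) :
  (forall i, a 0 i < b 0 i) -> ~ lebesgue_null (box a b).
Proof.
move=> ab nb; pose v := \prod_(i < d) (b 0 i - a 0 i).
have v0 : 0 < v by apply: prodr_gt0 => i _; rewrite subr_gt0.
have [|D [A [B [AB cov]]]] := nb (v / 2); first by rewrite divr_gt0.
apply/negP; rewrite -ltNge.
pose ext (z : 'rV[R]_d) k : R := if insub k is Some i then z 0 i else 0.
have extE z (i : 'I_d) : ext z i = z 0 i by rewrite /ext valK.
have := @box_cover_volume R d D (ext a) (ext b) (ext \o A) (ext \o B).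
have eqprod (y z : 'rV[R]_d) :
    \prod_(i < d) (ext y i - ext z i) = \prod_(i < d) (y 0 i - z 0 i).
  by apply: eq_bigr => i _; rewrite !extE.
rewrite eqprod -/v; under eq_esum do rewrite /= eqprod.
move=> H; apply: lt_le_trans (H _ _ _).
- by rewrite lte_fin ltr_pdivrMr// ltr_pMr// ltr1n.
- by move=> i; rewrite !extE ltW.
- by move=> k i; rewrite /= !extE.
- move=> x xab; have [|k Dk xk] := cov (\row_i x i).
    by move=> i; rewrite mxE -!extE.
  by exists k => // i; have := xk i; rewrite mxE /= !extE.
Qed.

(** Lets the covers below be indexed by pairs and by grid cells. *)
Lemma countable_cover (K : countType) S (e : R) (D : set K)
    (a b : K -> 'rV[R]_d) :
  (forall k i, a k 0 i <= b k 0 i) -> S `<=` \bigcup_(k in D) box (a k) (b k) ->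
  (\esum_(k in D) (\prod_(i < d) (b k 0 i - a k 0 i))%:E <= e%:E)%E ->
  exists (D : set nat) (a b : nat -> 'rV[R]_d),
    [/\ forall k i, a k 0 i <= b k 0 i,
        S `<=` \bigcup_(k in D) box (a k) (b k) &
        (\esum_(k in D) (\prod_(i < d) (b k 0 i - a k 0 i))%:E <= e%:E)%E].
Proof.
move=> ab cov le.
pose ext (c : K -> 'rV[R]_d) n :=
  if choice.unpickle n is Some k then c k else 0.
have extK c k : ext c (choice.pickle k) = c k by rewrite /ext choice.pickleK.
exists (choice.pickle @` D), (ext a), (ext b); split.
- by move=> n i; rewrite /ext; case: choice.unpickle.
- move=> x /cov[k Dk xk]; exists (choice.pickle k); first by exists k.
  by rewrite !extK.
- rewrite (@reindex_esum _ _ _ D _ (@choice.pickle K)).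
    by under eq_esum do rewrite !extK.
  by apply: inj_bij => k l _ _; exact: pcan_inj choice.pickleK _ _.
Qed.

Lemma lebesgue_null_bigcup (S : nat -> set 'rV[R]_d) :
  (forall n, lebesgue_null (S n)) -> lebesgue_null (\bigcup_n S n).
Proof.
move=> nS e e0.
have en0 n : 0 < e / (2 ^ n.+1)%:R by rewrite divr_gt0// ltr0n expn_gt0.
have /boolp.choice[D /boolp.choice[a /boolp.choice[b Dab]]] :=
  fun n => nS n _ (en0 n).
apply: (@countable_cover (nat * nat)%type _ _ (setT `*`` D)
  (fun p => a p.1 p.2) (fun p => b p.1 p.2)).
- by move=> [n k] i; case: (Dab n).
- move=> x [n _ Sx]; have [_ /(_ x Sx)[k Dk xk] _] := Dab n.
  by exists (n, k).
rewrite -(@esum_esum _ _ _ setT D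
  (fun n k => (\prod_(i < d) (b n k 0 i - a n k 0 i))%:E)); last first.
  move=> n k _ _; rewrite lee_fin; apply: prodr_ge0 => i _.
  by rewrite subr_ge0; case: (Dab n).
apply: le_trans (epsilon_trick0 xpredT (ltW e0)).
rewrite nneseries_esumT => [|n]; last by rewrite lee_fin ltW.
by apply: le_esum => n _; case: (Dab n).
Qed.

End NullSets.

Section Hyperplanes.
Context {R : realType}.

Lemma unit_cell (N : nat) (y : R) : 0 <= y <= N.+1%:R ->
  exists k : 'I_N.+1, k%:R <= y <= k%:R + 1.
Proof.
elim: N => [|N IH] /andP[y0 yN]; first by exists ord0; rewrite y0 add0r.
have [yN1|yN1] := lerP y N.+1%:R.
  by have [|k ky] := IH; [rewrite y0|exists (widen_ord (leqnSn _) k)].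
by exists ord_max; rewrite /= (ltW yN1) -natr1 in yN *.
Qed.

Section Patch.
Variables (d : nat) (a : 'cV[R]_d.+1) (c M : R) (i : 'I_d.+1).
Hypotheses (ai : a i 0 != 0) (M0 : 0 < M).

(** Over a grid of mesh 2 M / N in the other coordinates a bounded piece of a
    hyperplane is a graph of oscillation O(1 / N), hence covered by N ^ d boxes
    of volume O(1 / N ^ d.+1). *)
Lemma bounded_hyperplane_null : lebesgue_null
  [set x : 'rV[R]_d.+1 | lin a x = c /\ forall j, `|x 0 j| <= M].
Proof.
move=> e e0.
pose K := (\sum_(j < d) `|a (lift i j) 0|) / `|a i 0|.
have K0 : 0 <= K by rewrite divr_ge0// sumr_ge0.
pose V := (2 * M) ^+ d * (2 * K * (2 * M)).
pose N := Num.truncn (V / e).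
have VN : V / N.+1%:R <= e.
  rewrite ler_pdivrMr// mulrC -ler_pdivrMr// ltW//.
  exact: truncnS_gt.
pose delta := 2 * M / N.+1%:R.
have delta0 : 0 < delta by rewrite divr_gt0// mulr_gt0.
pose node (f : {ffun 'I_d -> 'I_N.+1}) j := - M + delta * (f j)%:R.
pose height f := (c - \sum_(j < d) node f j * a (lift i j) 0) / a i 0.
pose lo f : 'rV[R]_d.+1 := \row_k
  (if unlift i k is Some j then node f j else height f - K * delta).
pose hi f : 'rV[R]_d.+1 := \row_k
  (if unlift i k is Some j then node f j + delta else height f + K * delta).
apply: (@countable_cover _ _ {ffun 'I_d -> 'I_N.+1} _ _ setT lo hi).
- move=> f k; rewrite !mxE; case: unlift => [j|]; first by rewrite lerDl ltW.
  by have := mulr_ge0 K0 (ltW delta0); lra.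
- move=> x [xc xM].
  have /boolp.choice[f0 f0P] : forall j, exists k : 'I_N.+1,
      - M + delta * k%:R <= x 0 (lift i j) <= - M + delta * k%:R + delta.
    move=> j; have := xM (lift i j); rewrite ler_norml => /andP[x1 x2].
    have [|k /andP[k1 k2]] := @unit_cell N ((x 0 (lift i j) + M) / delta).
      rewrite divr_ge0 ?(ltW delta0)//=; last by lra.
      rewrite ler_pdivrMr// /delta mulrC divfK ?pnatr_eq0//; lra.
    exists k; move: k1 k2; rewrite ler_pdivlMr// ler_pdivrMr// => k1 k2.
    by apply/andP; split; lra.
  pose f := [ffun j => f0 j]; exists f => // k; rewrite !mxE.
  have fP j : node f j <= x 0 (lift i j) <= node f j + delta.
    by rewrite /node /f ffunE.
  case: unliftP => [j ->//|->].
  have xE : x 0 i = (c - \sum_(j < d) x 0 (lift i j) * a (lift i j) 0) / a i 0.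
    rewrite -xc /lin mxE (bigD1_ord i)//= addrK mulfK//.
  suff : `|x 0 i - height f| <= K * delta.
    by rewrite ler_norml => /andP[H1 H2]; apply/andP; split; lra.
  rewrite xE /height -mulrBl normrM normfV /K mulrAC ler_wpM2r ?invr_ge0//.
  rewrite opprB addrC addrA subrK -sumrB mulr_suml.
  apply: le_trans (ler_norm_sum _ _ _) _; apply: ler_sum => j _.
  rewrite -mulrBl normrM mulrC ler_wpM2l//.
  by have /andP[H1 H2] := fP j; rewrite ler_norml; apply/andP; split; lra.
have vol f : \prod_(k < d.+1) (hi f 0 k - lo f 0 k) =
    delta ^+ d * (2 * K * delta).
  rewrite (bigD1_ord i)//= !mxE unlift_none mulrC; congr (_ * _); last by ring.
  under eq_bigr do rewrite !mxE liftK addrAC subrr add0r.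
  by rewrite prodr_const card_ord.
under eq_esum do rewrite vol.
have vol0 : 0 <= delta ^+ d * (2 * K * delta).
  have d0 := ltW delta0.
  exact: mulr_ge0 (exprn_ge0 _ d0) (mulr_ge0 (mulr_ge0 (ler0n _ 2) K0) d0).
rewrite (_ : [set: {ffun 'I_d -> 'I_N.+1}] =
    [set` enum {: {ffun 'I_d -> 'I_N.+1}}]); last first.
  by apply/esym/seteqP; split=> // f _ /=; rewrite mem_enum.
rewrite esum_fset; [|exact: finite_seq|by move=> f _; rewrite lee_fin].
rewrite -fsbig_seq ?enum_uniq// sumEFin lee_fin big_enum/= sumr_const.
rewrite card_ffun !card_ord; apply: le_trans VN.
rewrite le_eqVlt; apply/orP; left; apply/eqP.
rewrite -[LHS]mulr_natl natrX /V /delta expr_div_n.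
have : N.+1%:R != 0 :> R by rewrite pnatr_eq0.
move: N.+1%:R => n n0; have nd0 : n ^+ d != 0 by rewrite expf_neq0.
by field; rewrite n0.
Qed.

End Patch.

Lemma hyperplane_null d (h : 'cV[R]_d * R) : h.1 != 0 ->
  lebesgue_null [set x | ev h x = 0].
Proof.
case: d h => [|d] [a c] /= a0.
  by move: a0; rewrite (_ : a = 0) ?eqxx//; apply/matrixP => -[].
have [i ai] : exists i, a i 0 != 0.
  apply: contrapT => H; move/eqP: a0; apply; apply/matrixP => i j.
  by rewrite [j]ord1 mxE; apply: contrapT => /eqP ai; apply: H; exists i.
apply: lebesgue_null_sub (lebesgue_null_bigcup (fun n =>
  bounded_hyperplane_null c ai (ltr0Sn R n))) => x /= hx.
exists (Num.truncn (\sum_j `|x 0 j|)) => //=; split.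
  by move: hx; rewrite /ev/=; lra.
move=> j; apply: le_trans (ltW (truncnS_gt _)).
by rewrite (bigD1 j)//= lerDl sumr_ge0.
Qed.

Lemma null_off d (s : seq ('cV[R]_d * R)) : lebesgue_null [set x | ~ off s x].
Proof.
pose H k : set 'rV[R]_d :=
  [set x | (nth (0, 0) s k).1 != 0 /\ ev (nth (0, 0) s k) x = 0].
apply: (@lebesgue_null_sub _ _ _ (\bigcup_k H k)).
  move=> x /= xs; apply: contrapT => nH; apply: xs => h hs h0.
  apply/eqP => hx; apply: nH; exists (index h s) => //.
  by rewrite /H /= nth_index.
apply: lebesgue_null_bigcup => k.
have [h0|h0] := eqVneq (nth (0, 0) s k).1 0.
  apply: lebesgue_null_sub lebesgue_null0 => x [].
  by rewrite h0 eqxx.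
by apply: lebesgue_null_sub (hyperplane_null h0) => x [].
Qed.

Lemma eq_off_eq_ae d (f g : 'rV[R]_d -> R) s :
  (forall x, off s x -> f x = g x) -> eq_ae f g.
Proof.
by move=> fg; apply: lebesgue_null_sub (null_off s) => x /= nfg /fg.
Qed.

Lemma sgr_near (c k : R) : `|k| < `|c| -> Num.sg (c + k) = Num.sg c.
Proof.
have := ler_norm k; have := ler_norm (- k); rewrite normrN => H1 H2 kc.
have [c0|c0|c0] := ltgtP c 0.
- by rewrite (ltr0_norm c0) in kc; rewrite !ltr0_sg//; lra.
- by rewrite (gtr0_norm c0) in kc; rewrite !gtr0_sg//; lra.
- by move: kc; rewrite c0 normr0 ltNge normr_ge0.
Qed.

(** Off finitely many hyperplanes polyhedral functions are locally constant,
    so a single disagreement there spreads to a whole box. *)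
Lemma eq_ae_eq_off d (f g : 'rV[R]_d -> R) : polyhedral f -> polyhedral g ->
  eq_ae f g -> exists s, forall x, off s x -> f x = g x.
Proof.
move=> [s sf] [t tg] fg; exists (s ++ t) => x xst; apply: contrapT => nfg.
pose bound (h : 'cV[R]_d * R) := \sum_j `|h.1 j 0|.
have lin_bound h (y : 'rV[R]_d) r : 0 <= r -> (forall j, `|y 0 j| <= r) ->
    `|lin h.1 y| <= r * bound h.
  move=> r0 yr; rewrite /lin mxE /bound mulr_sumr.
  apply: le_trans (ler_norm_sum _ _ _) _; apply: ler_sum => j _.
  by rewrite normrM ler_wpM2r.
have [r [r0 Hr]] : exists r : R, 0 < r /\ forall h, h \in s ++ t ->
    h.1 != 0 -> r * bound h < `|ev h x|.
  have : \forall r \near 0^'+, forall h, h \in s ++ t ->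
      h.1 != 0 -> r * bound h < `|ev h x|.
    apply: near_all => h hs; have [_|h0] := eqVneq h.1 0; first exact: nearW.
    have b1 : 0 < 1 + bound h by rewrite ltr_wpDr ?sumr_ge0.
    have e1 : 0 < `|ev h x| / (1 + bound h).
      by rewrite divr_gt0// normr_gt0 xst.
    near=> r => _.
    have : r < `|ev h x| / (1 + bound h) by near: r; exact: nbhs_right_lt.
    by rewrite ltr_pdivlMr// mulrDr mulr1; have : 0 < r by []; lra.
  by move=> H; have [r [r1 r2]] := filter_ex (filterI (nbhs_right_gt 0) H);
    exists r.
apply: (@not_null_box _ d (\row_j (x 0 j - r)) (\row_j (x 0 j + r))).
  by move=> j; rewrite !mxE; lra.
apply: lebesgue_null_sub fg => y yx /= fgy; apply: nfg.
have side h : h \in s ++ t -> Num.sg (ev h x) = Num.sg (ev h y).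
  move=> hst; have [h0|h0] := eqVneq h.1 0; first by rewrite (ev_const x y h0).
  have -> : y = x + (y - x) by rewrite addrC subrK.
  rewrite evD sgr_near//; apply: le_lt_trans (Hr h hst h0).
  apply: lin_bound; first exact: ltW.
  move=> j; have := yx j; rewrite !mxE => /andP[H1 H2].
  by rewrite ler_norml; apply/andP; split; lra.
rewrite (sf x y) ?(tg x y)// => h hs; apply: side; rewrite mem_cat hs ?orbT//.
Unshelve. all: by end_near. Qed.

End Hyperplanes.

(** * Indicators of polyhedra and tangent cones *)

Section Polyhedra.
Context {R : realType} {d : nat}.
Implicit Types (P Q : set 'rV[R]_d) (x y u v : 'rV[R]_d).
Implicit Types (s : seq ('cV[R]_d * R)).

Lemma eq_indic (T U : Type) (A : set T) (B : set U) a b :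
  (A a <-> B b) -> \1_A a = \1_B b :> R.
Proof.
move=> AB; rewrite !indicE; congr (nat_of_bool _)%:R.
by apply/idP/idP => /set_mem H; apply/mem_set; apply/AB.
Qed.

Definition forms_polyhedron s : set 'rV[R]_d :=
  [set x | {in s, forall h, (x *m h.1) 0 0 <= h.2}].

Lemma forms_polyhedronP s x :
  forms_polyhedron s x <-> forall h, h \in s -> ev h x <= 0.
Proof. by split=> H h hs; have := H h hs; rewrite /= /ev subr_le0. Qed.

Definition sided s P := forall x y, same_side s x y -> P x -> P y.

Lemma sided_indic s P : sided s P -> adapted s (\1_P : 'rV[R]_d -> R).
Proof.
by move=> sP x y xy; apply: eq_indic; split; apply: sP => // h hs; rewrite xy.
Qed.

Lemma sided_bigcup (n : nat) (Q : 'I_n -> set 'rV[R]_d) :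
  (forall i, exists s, sided s (Q i)) -> exists s, sided s (\bigcup_i Q i).
Proof.
move=> /boolp.choice[s sQ]; exists (flatten [seq s i | i <- enum 'I_n]).
move=> x y xy [i _ Qx]; exists i => //; apply: sQ Qx => h hs; apply: xy.
by apply/flattenP; exists (s i) => //; apply: map_f; rewrite mem_enum.
Qed.

Lemma sided_forms s : sided s (forms_polyhedron s).
Proof.
move=> x y xy /forms_polyhedronP Qx; apply/forms_polyhedronP => h hs.
by rewrite -sgr_le0 -xy// sgr_le0 Qx.
Qed.

Lemma sided_convex_tcone s v :
  exists t, sided t (convex_tcone (forms_polyhedron s) v).
Proof.
have [Qv|nQv] := pselect (forms_polyhedron s v).
  by rewrite convex_tcone_active//; eexists; exact: sided_forms.
by exists [::] => x y _ /convex_tconeP[].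
Qed.

Lemma convex_polyhedron_forms P :
  convex_polyhedron P -> exists s, P = forms_polyhedron s.
Proof. by move=> /convex_polyhedronP[s _ ->]; exists s. Qed.

Lemma polyhedral_indic P :
  generalized_polyhedron P -> polyhedral (\1_P : 'rV[R]_d -> R).
Proof.
move=> [n [Q [cQ ->]]]; have [|s sQ] := @sided_bigcup n Q.
  move=> i; have [s ->] := convex_polyhedron_forms (cQ i).
  by exists s; exact: sided_forms.
by exists s; exact: sided_indic.
Qed.

Lemma polyhedral_indic_tcone P v :
  generalized_polyhedron P -> polyhedral (\1_(tcone P v) : 'rV[R]_d -> R).
Proof.
move=> [n [Q PQ]]; rewrite (tconeE v PQ).
have [|s sQ] := @sided_bigcup n (fun i => convex_tcone (Q i) v).
  move=> i; have [s ->] := convex_polyhedron_forms (PQ.1 i).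
  exact: sided_convex_tcone.
by exists s; exact: sided_indic.
Qed.

Lemma convex_tcone_near s v x : near_side s v x ->
  forms_polyhedron s x <-> convex_tcone (forms_polyhedron s) v x.
Proof.
move=> vx; split=> [Qx|].
  apply/convex_tconeP; split; last first.
    by exists 1; rewrite ?ltr01// scale1r addrC subrK.
  apply/forms_polyhedronP => h hs; have [->//|hv] := eqVneq (ev h v) 0.
  by rewrite -sgr_le0 -(vx h hs hv) sgr_le0; move/forms_polyhedronP: Qx; apply.
move=> /convex_tconeP[/forms_polyhedronP Qv [e e0 /forms_polyhedronP Qe]].
apply/forms_polyhedronP => h hs; have [hv|hv] := eqVneq (ev h v) 0.
  have := Qe h hs; rewrite evD linZ hv add0r pmulr_rle0// linB.
  by move: hv; rewrite /ev; lra.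
by rewrite -sgr_le0 (vx h hs hv) sgr_le0; exact: Qv.
Qed.

Lemma tcone_near P v : generalized_polyhedron P ->
  exists s, forall x, near_side s v x -> P x <-> tcone P v x.
Proof.
move=> [n [Q PQ]]; have [cQ PE] := PQ.
have /boolp.choice[s sQ] := fun i => convex_polyhedron_forms (cQ i).
exists (flatten [seq s i | i <- enum 'I_n]) => x vx.
have H i : Q i x <-> convex_tcone (Q i) v x.
  rewrite sQ; apply: convex_tcone_near; apply: near_side_sub vx => h hs.
  by apply/flattenP; exists (s i) => //; apply: map_f; rewrite mem_enum.
rewrite (tconeE v PQ) PE.
by split=> -[i _ /H Hi]; exists i.
Qed.

Lemma convex_tcone_scale Q v x (e : R) : 0 < e ->
  convex_tcone Q v (v + e *: (x - v)) <-> convex_tcone Q v x.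
Proof.
move=> e0.
split=> /convex_tconeP[Qv [r r0 Qr]]; apply/convex_tconeP; split=> //.
  exists (r * e); first exact: mulr_gt0.
  by move: Qr; rewrite addrAC subrr add0r scalerA.
exists (r / e); first exact: divr_gt0.
by rewrite addrAC subrr add0r scalerA divfK// gt_eqF.
Qed.

(** The tangent cone records the germs at v of the indicator along rays. *)
Lemma tcone_germ P v x : generalized_polyhedron P ->
  \forall e \near 0^'+, (\1_P (v + e *: (x - v)) : R) = \1_(tcone P v) x.
Proof.
move=> gP; have [s sP] := tcone_near v gP.
have H : \forall e \near 0^'+, near_side s v (v + e *: (x - v)).
  by apply: near_near_side.
near=> e; have e0 : 0 < e by [].
have [n [Q PQ]] := gP; apply: eq_indic.
apply: iff_trans (sP _ _) _; first by near: e.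
by rewrite (tconeE v PQ); split=> -[i _ /(convex_tcone_scale _ _ _ e0) Hi];
  exists i.
Unshelve. all: by end_near. Qed.

(** Contrapositively: near v the set P is its tangent cone at v, which is empty
    if v is not in P; and a combination of indicators of line-cones is a sum of
    translation-invariant polyhedral functions. *)
Lemma not_locally_cylindrical_vertex P v : generalized_polyhedron P ->
  ~ locally_cylindrical (\1_P : 'rV[R]_d -> R) v -> algebraic_vertices P v.
Proof.
move=> gP nlc; have [s sP] := tcone_near v gP.
have indP x : near_side s v x -> \1_P x = \1_(tcone P v) x :> R.
  by move=> /sP; exact: eq_indic.
split.
  apply: contrapT => nPv; apply: nlc.
  exists 0%N, (fun=> fun=> 0), s; split=> [[]//|x xs _].
  rewrite indP// big_ord0 indicE memNset//.
  have [n [Q PQ]] := gP; rewrite (tconeE v PQ) => -[i _ /convex_tconeP[Qv _]].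
  by apply: nPv; rewrite PQ.2; exists i.
move=> [n [C [c [lC eC]]]]; apply: nlc.
have pC i : polyhedral (fun x => c i * \1_(C i) x).
  apply: polyhedral_map2 (polyhedral_cst _) _; apply: polyhedral_indic.
  by have [[p []]] := lC i.
have [t tC] := eq_ae_eq_off (polyhedral_indic_tcone v gP)
  (polyhedral_sum pC) eC.
exists n, (fun i x => c i * \1_(C i) x), (s ++ t); split=> [i|x xs xt].
  split=> //; right; have [_ [u [X [u0 CE]]]] := lC i; exists u => // x r.
  congr (_ * _); apply: eq_indic.
  rewrite CE; split=> -[z Xz [q _ e]]; exists z => //.
    by exists (q - r) => //; rewrite scalerBl addrA e addrK.
  by exists (q + r) => //; rewrite scalerDl addrA e.
rewrite indP; last by apply: near_side_sub xs => h hs; rewrite mem_cat hs.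
by apply: tC; apply: off_sub xt => h ht; rewrite mem_cat ht orbT.
Qed.

End Polyhedra.

(** * Simplices and their tangent cones *)

Section Simplices.
Context {R : realType} {d : nat}.
Implicit Types (A : {fset 'rV[R]_d}) (x y u v w : 'rV[R]_d).

(** Barycentric coordinates with respect to affinely independent points are
    affine, so a simplex is cut out by finitely many affine inequalities. *)
Lemma conv_hull_forms A : affinely_independent A ->
  exists s, conv_hull A = forms_polyhedron s.
Proof.
move=> iA; pose k := size A; pose w (i : 'I_k) : 'rV[R]_d := nth 0 A i.
have sumA (V : nmodType) (F : 'rV[R]_d -> V) :
    \sum_(v <- A) F v = \sum_(i < k) F (w i).
  by rewrite (big_nth 0) big_mkord.
pose fn (c : 'rV[R]_k) v : R :=
  if insub (index v A) is Some i then c 0 i else 0.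
have fnE c i : fn c (w i) = c 0 i by rewrite /fn index_uniq ?fset_uniq// valK.
pose M : 'M[R]_(k, d + 1) := row_mx (\matrix_(i, j) w i 0 j) (const_mx 1).
have cM (c : 'rV[R]_k) :
    c *m M = row_mx (\sum_(i < k) c 0 i *: w i) (const_mx (\sum_(i < k) c 0 i)).
  rewrite mul_mx_row; congr row_mx; apply/rowP => j; rewrite !mxE ?summxE.
    by apply: eq_bigr => i _; rewrite !mxE.
  by apply: eq_bigr => i _; rewrite !mxE mulr1.
have fM : row_free M.
  rewrite -kermx_eq0; apply/eqP/row_matrixP => i; rewrite row0.
  set c := row i _; have : c *m M = 0 by rewrite -row_mul mulmx_ker row0.
  rewrite cM -[RHS]row_mx0 => /eq_row_mx[c1 /rowP/(_ 0)]; rewrite !mxE => c0.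
  apply/rowP => j; rewrite [RHS]mxE -fnE; apply: (iA (fn c)).
  - by rewrite sumA; under eq_bigr do rewrite fnE.
  - by rewrite sumA; under eq_bigr do rewrite fnE.
  - by rewrite mem_nth.
pose Mi := pinvmx M; have MMi : M *m Mi = 1%:M by exact: mulmxVp.
pose hom x : 'rV[R]_(d + 1) := row_mx x (const_mx 1).
pose form r (N : 'M[R]_(d + 1, r)) (j : 'I_r) : 'cV[R]_d * R :=
  (col j (usubmx N), - (dsubmx N 0 j)).
have formE r (N : 'M[R]_(d + 1, r)) j x : ev (form r N j) x = (hom x *m N) 0 j.
  rewrite /ev /form /= opprK /hom -{3}[N]vsubmxK mul_row_col !mxE.
  rewrite big_ord1 !mxE mul1r; congr (_ + _); rewrite /lin mxE.
  by apply: eq_bigr => i _; rewrite !mxE.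
pose forms r (N : 'M[R]_(d + 1, r)) := [seq form r N j | j <- enum 'I_r].
have formsP r (N : 'M[R]_(d + 1, r)) x :
    (forall h, h \in forms r N -> ev h x <= 0) <->
    (forall j, (hom x *m N) 0 j <= 0).
  split=> [H j|H _ /mapP[j _ ->]]; last by rewrite formE.
  by rewrite -formE; apply: H; apply: map_f; rewrite mem_enum.
pose N0 := Mi *m M - 1%:M.
exists (forms _ (- Mi) ++ forms _ N0 ++ forms _ (- N0)).
have allc (s t : seq ('cV[R]_d * R)) x :
    (forall h, h \in s ++ t -> ev h x <= 0) <->
    (forall h, h \in s -> ev h x <= 0) /\ (forall h, h \in t -> ev h x <= 0).
  split=> [H|[H1 H2] h]; last by rewrite mem_cat => /orP[/H1|/H2].
  by split=> h hs; apply: H; rewrite mem_cat hs ?orbT.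
apply/seteqP; split=> x.
  move=> [c [c0 c1 xE]]; pose cr : 'rV[R]_k := \row_i c (w i).
  have crM : cr *m M = hom x.
    rewrite cM /hom xE sumA -[in RHS]c1 sumA; congr (row_mx _ (const_mx _)).
      by apply: eq_bigr => i _; rewrite mxE.
    by apply: eq_bigr => i _; rewrite mxE.
  have crE : hom x *m Mi = cr by rewrite -crM -mulmxA MMi mulmx1.
  have N00 : hom x *m N0 = 0 by rewrite mulmxBr mulmxA crE crM mulmx1 subrr.
  apply/forms_polyhedronP/allc; split; last first.
    by apply/allc; split; apply/formsP => j; rewrite ?mulmxN N00 !mxE// oppr0.
  apply/formsP => j; rewrite mulmxN crE !mxE oppr_le0; apply: c0.
  by rewrite mem_nth.
move=> /forms_polyhedronP/allc[/formsP c0 /allc[/formsP H1 /formsP H2]].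
have N00 : hom x *m N0 = 0.
  apply/rowP => j; rewrite [RHS]mxE; apply/eqP; rewrite eq_le H1/=.
  by have := H2 j; rewrite mulmxN mxE oppr_le0.
pose c := hom x *m Mi.
have cME : c *m M = hom x.
  by apply/eqP; rewrite -subr_eq0 -mulmxA -[X in _ - X]mulmx1 -mulmxBr N00.
move: cME; rewrite cM => /eq_row_mx[xE /rowP/(_ 0)]; rewrite !mxE => c1.
exists (fn c); split.
- move=> v vA; have iv : (index v A < k)%N by rewrite index_mem.
  have -> : v = w (Ordinal iv) by rewrite /w nth_index.
  by rewrite fnE; have := c0 (Ordinal iv); rewrite mulmxN mxE oppr_le0.
- by rewrite sumA; under eq_bigr do rewrite fnE.
- by rewrite sumA -xE; apply: eq_bigr => i _; rewrite fnE.
Qed.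

Lemma polyhedral_simplex A :
  simplex A -> polyhedral (\1_(conv_hull A) : 'rV[R]_d -> R).
Proof.
move=> [_ /conv_hull_forms[s ->]]; exists s.
exact: sided_indic (@sided_forms _ _ s).
Qed.

Lemma sum_fset_indic A w : w \in A -> \sum_(v <- A) (v == w)%:R = 1 :> R.
Proof.
move=> wA; rewrite (bigD1_seq w) ?fset_uniq//= eqxx big1 ?addr0// => v.
by move=> /negbTE ->.
Qed.

Lemma sum_fset_indicZ A w : w \in A -> \sum_(v <- A) (v == w)%:R *: v = w.
Proof.
move=> wA; rewrite (bigD1_seq w) ?fset_uniq//= eqxx scale1r big1 ?addr0// => v.
by move=> /negbTE ->; rewrite scale0r.
Qed.

(** A point of a simplex that is not a vertex has two positive barycentric
    coordinates, and can be moved along the line joining the two vertices. *)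
Lemma simplex_segment A v : conv_hull A v -> v \notin A ->
  exists u, u != 0 /\ exists2 e, 0 < e &
    conv_hull A (v + e *: u) /\ conv_hull A (v - e *: u).
Proof.
move=> [c [c0 c1 vE]] vA.
have [w1 w1A cw1] : exists2 w, w \in A & c w != 0.
  apply: contrapT => H; move: c1; rewrite big_seq big1 => [/eqP|w wA].
    by rewrite eq_sym oner_eq0.
  by apply: contrapT => /eqP cw; apply: H; exists w.
have [w2 [w2A w21 cw2]] : exists w, [/\ w \in A, w != w1 & c w != 0].
  apply: contrapT => H.
  have cE w : w \in A -> w != w1 -> c w = 0.
    by move=> wA ww; apply: contrapT => /eqP cw; apply: H; exists w.
  have c11 : c w1 = 1.
    move: c1; rewrite (bigD1_seq w1) ?fset_uniq//= big_seq_cond big1 ?addr0//.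
    by move=> w /andP[wA ww]; exact: cE.
  move: vA; rewrite vE (bigD1_seq w1) ?fset_uniq//= c11 scale1r.
  rewrite big_seq_cond big1 ?addr0 ?w1A//.
  by move=> w /andP[wA ww]; rewrite cE// scale0r.
have p1 : 0 < c w1 by rewrite lt_neqAle eq_sym cw1 c0.
have p2 : 0 < c w2 by rewrite lt_neqAle eq_sym cw2 c0.
pose e := Num.min (c w1) (c w2).
have e0 : 0 < e by rewrite lt_min p1 p2.
have e1 : e <= c w1 by rewrite ge_min lexx.
have e2 : e <= c w2 by rewrite ge_min lexx orbT.
have move_along r : - e <= r <= e -> conv_hull A (v + r *: (w1 - w2)).
  move=> /andP[r1 r2].
  exists (fun z => c z + r * ((z == w1)%:R - (z == w2)%:R)); split.
  - move=> z zA; have := c0 z zA; have [->|_] := eqVneq z w1.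
      by rewrite eq_sym (negbTE w21) /=; lra.
    by have [->|_] := eqVneq z w2 => /=; lra.
  - rewrite big_split/= c1 -mulr_sumr sumrB !sum_fset_indic//.
    by rewrite subrr mulr0 addr0.
  - under eq_bigr do rewrite scalerDl -scalerA scalerBl.
    by rewrite big_split/= -vE -scaler_sumr sumrB !sum_fset_indicZ.
exists (w1 - w2); split; first by rewrite subr_eq0 eq_sym.
exists e => //; split; first by apply: move_along; lra.
by rewrite -scaleNr; apply: move_along; lra.
Qed.

Lemma forms_convex_polyhedron u (s : seq ('cV[R]_d * R)) :
  u != 0 -> convex_polyhedron (forms_polyhedron s).
Proof.
move=> u0.
have [[h [hs h0 h2]]|H] := pselect (exists h, [/\ h \in s, h.1 = 0 & h.2 < 0]).
  rewrite (_ : forms_polyhedron s = set0); first exact: convex_polyhedron0 u0.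
  rewrite -subset0 => x /(_ h hs); rewrite h0 mulmx0 mxE.
  by move/(lt_le_trans h2); rewrite ltxx.
apply/convex_polyhedronP; exists [seq h <- s | h.1 != 0].
  by move=> h; rewrite mem_filter => /andP[].
apply/seteqP; split=> x Hx h; first by rewrite mem_filter => /andP[_ /Hx].
move=> hs; have [h0|h0] := eqVneq h.1 0; last first.
  by apply: Hx; rewrite mem_filter h0.
rewrite h0 mulmx0 mxE leNgt; apply/negP => h2.
by apply: H; exists h.
Qed.

(** Forms active at v vanish on the direction u of a segment around v inside the
    simplex, so the tangent cone is invariant under u; outside the simplex the
    tangent cone is empty. *)
Lemma line_cone_tcone_simplex A v : simplex A -> v \notin A ->
  line_cone (convex_tcone (conv_hull A) v).
Proof.
move=> [A0 iA] vA; have [s sE] := conv_hull_forms iA.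
have [Qv|nQv] := pselect (conv_hull A v); last first.
  have -> : convex_tcone (conv_hull A) v = set0.
    by rewrite -subset0 => x /convex_tconeP[].
  have /fset0Pn[w wA] := A0.
  split.
    exists 0; split=> //; exists 0%N, (fun=> set0); split; first by case.
    by apply/esym; rewrite -subset0 => x [[]].
  exists (w - v), set0; split; last by rewrite bigcup_set0.
  by rewrite subr_eq0; apply: contraNneq vA => <-.
have [u [u0 [e e0 []]]] := simplex_segment Qv vA.
rewrite sE in Qv *; move=> /forms_polyhedronP Q1 /forms_polyhedronP Q2.
have act := convex_tcone_active Qv.
split.
  exists v; split.
    exists 1%N, (fun=> convex_tcone (forms_polyhedron s) v).
    split=> [_|]; last by apply/esym/bigcup_const; exists ord0.
    by rewrite act; exact: forms_convex_polyhedron u0.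
  move=> x Cx t; rewrite le_eqVlt => /predU1P[<-|t0]; last first.
    exact/convex_tcone_scale.
  rewrite scale0r addr0; apply/convex_tconeP; split=> //; exists 1 => //.
  by rewrite subrr scaler0 addr0.
exists u, (convex_tcone (forms_polyhedron s) v); split=> //.
apply/seteqP; split=> x.
  by move=> Cx; exists x => //; exists 0 => //; rewrite scale0r addr0.
move=> [y + [t _ <-]]; rewrite act => Cy h hs; have := Cy h hs.
move: hs; rewrite mem_filter => /andP[/eqP hv hs].
have hv0 : ev h v = 0 by rewrite /ev /lin hv subrr.
have hu : lin h.1 u = 0.
  have := Q1 h hs; have := Q2 h hs; rewrite !evD hv0 !add0r linN !linZ.
  rewrite oppr_le0 pmulr_rge0// pmulr_rle0// => H1 H2.
  by apply/eqP; rewrite eq_le H1 H2.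
by rewrite -!/(lin _ _) linD linZ hu mulr0 addr0.
Qed.

(** Otherwise taking germs at v would turn the given identity into a
    representation of the tangent cone by line-cones.  Germs in the direction
    x - v respect the identity unless x - v is parallel to an exceptional
    hyperplane. *)
Lemma simplices_cover_vertices P (n : nat) (T : 'I_n -> {fset 'rV[R]_d})
    (c : 'I_n -> R) :
  generalized_polyhedron P -> (forall i, simplex (T i)) ->
  eq_ae \1_P (fun x => \sum_(i < n) c i * \1_(conv_hull (T i)) x) ->
  algebraic_vertices P `<=` \bigcup_i [set` T i].
Proof.
move=> gP sT PT v [Pv nlc]; apply: contrapT => nT; apply: nlc.
have vT i : v \notin T i by apply/negP => vTi; apply: nT; exists i.
have pT i : polyhedral (fun x => c i * \1_(conv_hull (T i)) x).
  exact: polyhedral_map2 (polyhedral_cst _) (polyhedral_simplex (sT i)).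
have [s PTs] := eq_ae_eq_off (polyhedral_indic gP) (polyhedral_sum pT) PT.
exists n, (fun i => convex_tcone (conv_hull (T i)) v), c; split.
  by move=> i; exact: line_cone_tcone_simplex.
apply: (@eq_off_eq_ae _ _ _ _ [seq (h.1, lin h.1 v) | h <- s]) => x xs.
have off_e : \forall e \near 0^'+, off s (v + e *: (x - v)).
  apply: near_off => h hs h0 _.
  by have := xs _ (map_f _ hs) h0; rewrite /ev /= linB.
have germ_T : \forall e \near 0^'+, forall i,
    \1_(conv_hull (T i)) (v + e *: (x - v)) =
    \1_(convex_tcone (conv_hull (T i)) v) x :> R.
  apply: filter_forall => i; have [t ->] := conv_hull_forms (sT i).2.
  have H := near_near_side (x - v) (_ : near_side t v v).
  near=> e; have e0 : 0 < e by [].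
  apply: eq_indic; apply: iff_trans (convex_tcone_scale _ _ _ e0).
  by apply: convex_tcone_near; near: e; exact: H.
have [e [[e1 e2] e3]] := filter_ex (filterI (filterI off_e germ_T)
  (tcone_germ v x gP)).
rewrite -e3 PTs//.
by apply: eq_bigr => i _; rewrite e2.
Unshelve. all: by end_near. Qed.

Lemma bounded_set_support P :
  bounded_set P -> bounded_support (\1_P : 'rV[R]_d -> R).
Proof.
move=> [M [_ HM]] a; exists ((M + 1) * \sum_j `|a j 0|) => x.
rewrite indicE => Px.
have {}Px : P x by apply: contrapT => nP; move: Px; rewrite memNset// eqxx.
have xM : `|x| <= M + 1 by apply: HM => //; rewrite ltrDl.
rewrite /lin mxE mulr_sumr; apply: le_trans (ler_norm_sum _ _ _) _.
apply: ler_sum => j _; rewrite normrM ler_wpM2r//.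
apply: le_trans xM; rewrite [leRHS]mx_normrE.
exact: (le_bigmax _ (fun ij => `|x ij.1 ij.2|) (0, j)).
Qed.

End Simplices.

(** * Minimality and existence of the decomposition *)

Theorem theorem1 (R : realType) (d : nat) (P : set 'rV[R]_d)
    (hP : generalized_polytope P) :
  (exists alpha : {fset 'rV[R]_d} -> int,
     eq_ae \1_P (fun x => \sum_(T \in simplices_on (algebraic_vertices P))
                            (alpha T)%:~R * (\1_(conv_hull T) x : R))) /\
  (forall (n : nat) (T : 'I_n -> {fset 'rV[R]_d}) (c : 'I_n -> R),
     (forall i, simplex (T i)) ->
     eq_ae \1_P (fun x => \sum_(i < n) c i * \1_(conv_hull (T i)) x) ->
     algebraic_vertices P `<=` \bigcup_i [set` T i]).
Proof.
have [gP bP] := hP.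
split; last by move=> n T c sT PT; exact: simplices_cover_vertices PT.
have [||x|l [s [lV lE]]] := @simplicial_decomposition R d \1_P.
- exact: polyhedral_indic.
- exact: bounded_set_support.
- by rewrite indicE; exists (x \in P)%:R; case: (x \in P).
(* A simplex may occur several times in the list l. *)
exists (fun T => \sum_(q <- l | q.2 == T) q.1).
apply: eq_off_eq_ae => x /lE ->.
have finV := finite_simplices_on (finite_algebraic_vertices gP).
rewrite fsbig_finite//=.
under [RHS]eq_bigr do rewrite raddf_sum/= mulr_suml.
rewrite (exchange_big_dep xpredT)//= big_seq [RHS]big_seq.
apply: eq_bigr => q ql.
rewrite big_mkcond (bigD1_seq q.2) ?fset_uniq//=; last first.
  have [qs qV] := lV q ql; rewrite in_fset_set// inE; split=> // v vq.
  exact: not_locally_cylindrical_vertex gP (qV v vq).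
by rewrite eqxx big1 ?addr0// => T /negbTE; rewrite eq_sym => ->.
Qed.
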